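(* Let $m\ge3$ be an odd integer and $n$ an integer with $2m<n$. Let $\lambda$ and $b$ be constants with $$0<\lambda<\frac{n}{n-2m},\qquad b=\frac{2m(n-2)}{n-\lambda(n-2m)}.$$ Let $\varphi:(1,\infty)\to(0,1)$ be continuous with $\lim_{r\to\infty}\varphi(r)=0$. Then there exists a $C^\infty$ positive solution $v$ of $$0\le-\Delta^m v\le v^\lambda\quad\text{in }\mathbb{R}^n\setminus\{0\}$$ such that $v(y)\neq O(\varphi(|y|)|y|^b)$ as $|y|\to\infty$.
   Context: $\Delta^m$ is the $m$-fold iterated Laplacian. For positive functions, ''$v(y)\neq O(h(y))$ as $|y|\to\infty$'' means $\limsup_{|y|\to\infty} v(y)/h(y)=\infty$. *)

(* Defs.v *)
From Stdlib Require Import Reals ClassicalEpsilon Arith.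
Open Scope R_scope.

(* Points of R^n are encoded as x : nat -> R whose coordinates j >= n vanish. *)
Definition upd (x : nat -> R) (i : nat) (t : R) : nat -> R :=
  fun j => if Nat.eqb j i then t else x j.

Fixpoint sum_lt (n : nat) (F : nat -> R) : R :=
  match n with O => 0 | S k => sum_lt k F + F k end.

Definition normn (n : nat) (x : nat -> R) : R := sqrt (sum_lt n (fun j => x j ^ 2)).
Definition distn (n : nat) (x y : nat -> R) : R := normn n (fun j => x j - y j).

Definition punctured (n : nat) (x : nat -> R) : Prop :=
  (forall j, (n <= j)%nat -> x j = 0) /\ exists j, (j < n)%nat /\ x j <> 0.

(* the derivative of a one-variable function (the unique l, when it exists) *)
Definition deriv1 (g : R -> R) (t : R) : R :=
  epsilon (inhabits 0) (fun l => derivable_pt_lim g t l).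

Definition partial (i : nat) (f : (nat -> R) -> R) : (nat -> R) -> R :=
  fun x => deriv1 (fun t => f (upd x i t)) (x i).

Definition Dl (l : list nat) (f : (nat -> R) -> R) : (nat -> R) -> R :=
  List.fold_right partial f l.

Definition laplacian (n : nat) (f : (nat -> R) -> R) : (nat -> R) -> R :=
  fun x => sum_lt n (fun i => partial i (partial i f) x).
Definition iter_lap (m n : nat) (f : (nat -> R) -> R) : (nat -> R) -> R :=
  Nat.iter m (laplacian n) f.

Definition cont_punct (n : nat) (g : (nat -> R) -> R) : Prop :=
  forall x, punctured n x -> forall eps, 0 < eps -> exists delta, 0 < delta /\
    forall y, punctured n y -> distn n x y < delta -> Rabs (g y - g x) < eps.

Definition smooth_punct (n : nat) (f : (nat -> R) -> R) : Prop :=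
  forall l : list nat, List.Forall (fun i => (i < n)%nat) l ->
    cont_punct n (Dl l f) /\
    forall i x, (i < n)%nat -> punctured n x ->
      exists d, derivable_pt_lim (fun t => Dl l f (upd x i t)) (x i) d.

(* Main.v *)
Require Import Defs.
From Stdlib Require Import Reals Arith.
From Stdlib Require Import Lra Lia FunctionalExtensionality ClassicalEpsilon.
From Coquelicot Require Import Coquelicot.
Open Scope R_scope.

(* Every term of v = sum_j W_j is a bubble mu (r^2 + |y - d e_0|^2)^(-(n/2 - m)), whose
   (-Laplacian)^m is a positive multiple of mu r^(2m) (r^2 + |y - d e_0|^2)^(-(n/2 + m)),
   minus its Taylor polynomial of degree 2m - 3 at the origin, which (-Laplacian)^m kills,
   plus 2^(-j-1) (1 + |y|^(2m-2)), which is killed too and keeps the term positive when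
   mu is at most a small multiple of 2^(-j) d^(n-2).  The Taylor correction is what makes
   sum_j converge for such large masses.  Taking r^D = const * 2^j mu^(1-lam) with
   D = n - lam (n - 2m) gives source <= 2^(-j-1) v^lam for each j: from v >= bubble away
   from the origin, from v >= 1 near it.  The peak mu r^(2m-n) is then eta_j d^b with eta_j
   independent of d, and d = d_j is chosen after eta_j, so large that phi(d) is below
   eta_j / (j + 1). *)

(** * Taylor polynomials of the bubble *)

(** The exponent n - 2 of the mass is dictated by the correction. Near the origin an uncorrected
    bubble has size mu d^(2m-n), so summability would stop at masses of order d^(n-2m). A Taylor
    remainder of order 2m-2 has size mu |y|^(2m-2) d^(2-n) there, which allows mu of order d^(n-2).
    The order cannot be raised in the same way, because a possibly negative remainder has to be
    outweighed by |y|^(2m-2), the highest power of |y|^2 that the m-fold Laplacian annihilates. The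
    value of b follows: 1 - (1 - lam)(n - 2m)/D = 2m/D, so mu r^(2m-n) is a constant times
    mu^(2m/D), and mu^(2m/D) is a constant times d^(2m(n-2)/D) = d^b. The remaining obstacle is to
    differentiate the series term by term, to every order. For this the remainders are indexed by an
    order K and an exponent a: a derivative only moves (K, a) to (K-1, a+1) and (K-2, a+1), so a
    single pair of estimates, uniform in r, serves all derivatives. Since r > 0, every term is
    smooth across the origin as well, and all derivative statements can be made on the whole
    space. *)

Lemma sum_lt_ext n F G :
  (forall i, (i < n)%nat -> F i = G i) -> sum_lt n F = sum_lt n G.
Proof.
  induction n as [|n IH]; intros H; simpl; [reflexivity|].
  rewrite IH by (intros; apply H; lia). rewrite H by lia. reflexivity.
Qed.

Lemma sum_lt_plus n F G :
  sum_lt n (fun i => F i + G i) = sum_lt n F + sum_lt n G.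
Proof. induction n as [|n IH]; simpl; [ring|]. rewrite IH; ring. Qed.

Lemma sum_lt_scal n c F : sum_lt n (fun i => c * F i) = c * sum_lt n F.
Proof. induction n as [|n IH]; simpl; [ring|]. rewrite IH; ring. Qed.

Lemma sum_lt_const n c : sum_lt n (fun _ => c) = INR n * c.
Proof.
  induction n as [|n IH]; [simpl; ring|]. rewrite S_INR. simpl. rewrite IH; ring.
Qed.

Lemma sum_lt_le n F G :
  (forall i, (i < n)%nat -> F i <= G i) -> sum_lt n F <= sum_lt n G.
Proof.
  induction n as [|n IH]; intros H; simpl; [lra|].
  apply Rplus_le_compat; [apply IH; intros; apply H; lia | apply H; lia].
Qed.

Lemma sum_lt_nonneg n F : (forall i, (i < n)%nat -> 0 <= F i) -> 0 <= sum_lt n F.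
Proof.
  intros H. replace 0 with (sum_lt n (fun _ => 0)) by (rewrite sum_lt_const; ring).
  now apply sum_lt_le.
Qed.

Lemma sum_lt_term_le n F i :
  (forall j, (j < n)%nat -> 0 <= F j) -> (i < n)%nat -> F i <= sum_lt n F.
Proof.
  induction n as [|n IH]; intros H Hi; [lia|]. simpl.
  destruct (Nat.eq_dec i n) as [->|Hne].
  - assert (0 <= sum_lt n F) by (apply sum_lt_nonneg; intros; apply H; lia). lra.
  - assert (F i <= sum_lt n F) by (apply IH; [intros; apply H; lia | lia]).
    assert (0 <= F n) by (apply H; lia). lra.
Qed.

Lemma sum_lt_pred n F :
  sum_lt n (fun k => match k with O => 0 | S k' => F k' end) = sum_lt (n - 1) F.
Proof.
  induction n as [|n IH]; [reflexivity|]. simpl sum_lt at 1. rewrite IH.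
  destruct n as [|n]; simpl; [ring|]. now rewrite !Nat.sub_0_r.
Qed.

Lemma sum_lt_head n c F :
  (0 < n)%nat -> sum_lt n (fun i => (if Nat.eqb i 0 then c else 0) * F i) = c * F O.
Proof.
  destruct n as [|n]; [lia|]. intros _.
  induction n as [|n IH]; [simpl; ring|].
  change (sum_lt (S n) (fun i => (if Nat.eqb i 0 then c else 0) * F i) + 0 * F (S n) = c * F O).
  rewrite IH; ring.
Qed.

Lemma derivable_pt_lim_val f x a b :
  derivable_pt_lim f x a -> a = b -> derivable_pt_lim f x b.
Proof. now intros H <-. Qed.

Lemma derivable_pt_lim_add f g x a b :
  derivable_pt_lim f x a -> derivable_pt_lim g x b ->
  derivable_pt_lim (fun t => f t + g t) x (a + b).
Proof. exact (derivable_pt_lim_plus f g x a b). Qed.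

Lemma derivable_pt_lim_sub f g x a b :
  derivable_pt_lim f x a -> derivable_pt_lim g x b ->
  derivable_pt_lim (fun t => f t - g t) x (a - b).
Proof. exact (derivable_pt_lim_minus f g x a b). Qed.

Lemma derivable_pt_lim_mul f g x a b :
  derivable_pt_lim f x a -> derivable_pt_lim g x b ->
  derivable_pt_lim (fun t => f t * g t) x (a * g x + f x * b).
Proof. exact (derivable_pt_lim_mult f g x a b). Qed.

Lemma derivable_pt_lim_cst c x : derivable_pt_lim (fun _ => c) x 0.
Proof. exact (derivable_pt_lim_const c x). Qed.

Lemma derivable_pt_lim_cmul c f x a :
  derivable_pt_lim f x a -> derivable_pt_lim (fun t => c * f t) x (c * a).
Proof. exact (derivable_pt_lim_scal f c x a). Qed.

Lemma derivable_pt_lim_sum_lt n (F : nat -> R -> R) (F' : nat -> R) x :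
  (forall i, (i < n)%nat -> derivable_pt_lim (F i) x (F' i)) ->
  derivable_pt_lim (fun t => sum_lt n (fun i => F i t)) x (sum_lt n F').
Proof.
  induction n as [|n IH]; intros H; simpl; [apply derivable_pt_lim_cst|].
  apply (derivable_pt_lim_add (fun t => sum_lt n (fun i => F i t)) (F n)).
  - apply IH; intros; apply H; lia.
  - apply H; lia.
Qed.

(* Gegenbauer polynomials: (A - 2 p t + q t^2)^(-a) = sum_k geg k a A p q t^k.  The
   recursion is Euler's identity for homogeneous functions; it makes the derivative rules
   in p and q immediate by induction. *)
Fixpoint geg (k : nat) (a A p q : R) {struct k} : R :=
  match k with
  | O => Rpower A (- a)
  | S k1 =>
      2 * a / INR (S k1) *
      (p * geg k1 (a + 1) A p q
       - q * match k1 with O => 0 | S k2 => geg k2 (a + 1) A p q end)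
  end.

Definition geg1 (k : nat) (a A p q : R) : R :=
  match k with O => 0 | S k' => geg k' a A p q end.
Definition geg2 (k : nat) (a A p q : R) : R :=
  match k with O => 0 | S k' => geg1 k' a A p q end.

Lemma geg_euler k a A p q :
  INR k * geg k a A p q
  = 2 * a * (p * geg1 k (a + 1) A p q - q * geg2 k (a + 1) A p q).
Proof.
  destruct k as [|k]; [simpl; ring|].
  assert (INR (S k) <> 0) by (apply not_0_INR; lia).
  change (geg (S k) a A p q) with
    (2 * a / INR (S k) * (p * geg1 (S k) (a + 1) A p q - q * geg2 (S k) (a + 1) A p q)).
  field; assumption.
Qed.

Lemma Rpower_mul_self A a : 0 < A -> A * Rpower A (- (a + 1)) = Rpower A (- a).
Proof.
  intros HA. rewrite <- (Rpower_1 A) at 1 by assumption.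
  rewrite <- Rpower_plus. f_equal; ring.
Qed.

(** This is the coefficient of t^k in (A - 2pt + qt^2) (A - 2pt + qt^2)^(-a-1) = (A - 2pt +
    qt^2)^(-a). Multiplied by k, Euler's identity turns it into the same statement at orders k-1 and
    k-2 with exponent a+1. *)
Lemma geg_mul k : forall a A p q, 0 < A ->
  A * geg k (a + 1) A p q - 2 * p * geg1 k (a + 1) A p q + q * geg2 k (a + 1) A p q
  = geg k a A p q.
Proof.
  induction k as [k IH] using lt_wf_ind; intros a A p q HA.
  destruct k as [|k].
  - simpl geg. simpl geg1. simpl geg2.
    transitivity (A * Rpower A (- (a + 1))); [ring|]. now apply Rpower_mul_self.
  - assert (Hk : INR (S k) <> 0) by (apply not_0_INR; lia).
    pose proof (geg_euler (S k) a A p q) as E0.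
    pose proof (geg_euler (S k) (a + 1) A p q) as E1.
    pose proof (geg_euler k (a + 1) A p q) as E2.
    pose proof (IH k ltac:(lia) (a + 1) A p q HA) as I1.
    apply Rmult_eq_reg_l with (INR (S k)); [|assumption].
    rewrite E0.
    destruct k as [|k].
    + unfold geg2, geg1 in *. rewrite S_INR in *. simpl (INR 0) in *.
      set (G := geg 1 (a + 1) A p q) in *.
      set (H := geg 0 (a + 1) A p q) in *.
      set (L := geg 0 (a + 1 + 1) A p q) in *.
      replace ((0 + 1) * (A * G - 2 * p * H + q * 0)) with
        (A * ((0 + 1) * G) - 2 * p * H) by ring.
      rewrite E1. rewrite <- I1. ring.
    + pose proof (geg_euler k (a + 1) A p q) as E3.
      pose proof (IH k ltac:(lia) (a + 1) A p q HA) as I2.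
      change (geg1 (S (S k)) (a + 1) A p q) with (geg (S k) (a + 1) A p q) in *.
      change (geg2 (S (S k)) (a + 1) A p q) with (geg k (a + 1) A p q) in *.
      change (geg1 (S (S k)) (a + 1 + 1) A p q) with (geg (S k) (a + 1 + 1) A p q) in *.
      change (geg2 (S (S k)) (a + 1 + 1) A p q) with (geg k (a + 1 + 1) A p q) in *.
      change (geg1 (S k) (a + 1 + 1) A p q) with (geg k (a + 1 + 1) A p q) in *.
      change (geg2 (S k) (a + 1 + 1) A p q) with (geg1 k (a + 1 + 1) A p q) in *.
      rewrite !S_INR in *.
      revert E0 E1 E2 E3 I1 I2.
      generalize (geg (S (S k)) (a + 1) A p q) (geg (S k) (a + 1) A p q)
        (geg k (a + 1) A p q) (geg (S k) (a + 1 + 1) A p q) (geg k (a + 1 + 1) A p q)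
        (geg1 k (a + 1 + 1) A p q) (geg2 k (a + 1 + 1) A p q) (INR k)
        (geg (S (S k)) a A p q).
      intros G2 G1 G0 L1 L0 M N K Z E0 E1 E2 E3 I1 I2.
      (* Each coefficient is paired with its own index, so that Euler's identity applies to all
         three of them. *)
      replace ((K + 1 + 1) * (A * G2 - 2 * p * G1 + q * G0)) with
        (A * ((K + 1 + 1) * G2) - 2 * p * ((K + 1) * G1) - 2 * p * G1
         + q * (K * G0) + 2 * q * G0) by ring.
      rewrite E1, E2, E3.
      rewrite <- I1, <- I2. ring.
Qed.

(** Coefficientwise, d/dp (A - 2pt + qt^2)^(-a) = 2at (...)^(-a-1) and d/dq = -a t^2 (...)^(-a-1).
    Curves [P], [Q] are allowed so that one rule covers both the coordinate lines of R^n and the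
    rays to the origin. *)
Lemma geg_deriv k : forall a A P Q t p' q',
  derivable_pt_lim P t p' -> derivable_pt_lim Q t q' ->
  derivable_pt_lim (fun u => geg k a A (P u) (Q u)) t
    (2 * a * geg1 k (a + 1) A (P t) (Q t) * p' - a * geg2 k (a + 1) A (P t) (Q t) * q').
Proof.
  induction k as [k IH] using lt_wf_ind; intros a A P Q t p' q' HP HQ.
  destruct k as [|k].
  - apply derivable_pt_lim_val with 0;
      [exact (derivable_pt_lim_cst (Rpower A (- a)) t)|simpl; ring].
  - assert (Hk : INR (S k) <> 0) by (apply not_0_INR; lia).
    pose proof (geg_euler k (a + 1) A (P t) (Q t)) as E1.
    pose proof (IH k ltac:(lia) (a + 1) A P Q t p' q' HP HQ) as D1.
    destruct k as [|k].
    + eapply derivable_pt_lim_val.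
      * apply (derivable_pt_lim_cmul (2 * a / INR 1)).
        apply derivable_pt_lim_sub.
        -- exact (derivable_pt_lim_mul _ _ _ _ _ HP D1).
        -- exact (derivable_pt_lim_mul _ _ _ _ _ HQ (derivable_pt_lim_cst 0 t)).
      * unfold geg2, geg1. simpl INR. field.
    + pose proof (geg_euler k (a + 1) A (P t) (Q t)) as E2.
      pose proof (IH k ltac:(lia) (a + 1) A P Q t p' q' HP HQ) as D2.
      eapply derivable_pt_lim_val.
      * apply (derivable_pt_lim_cmul (2 * a / INR (S (S k)))).
        apply derivable_pt_lim_sub.
        -- exact (derivable_pt_lim_mul _ _ _ _ _ HP D1).
        -- exact (derivable_pt_lim_mul _ _ _ _ _ HQ D2).
      * change (geg1 (S (S k))) with (geg (S k)).
        change (geg2 (S (S k))) with (geg k).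
        change (geg1 (S k)) with (geg k) in *. change (geg2 (S k)) with (geg1 k) in *.
        rewrite !S_INR in *. cbv beta.
        revert Hk E1 E2.
        generalize (geg (S k) (a + 1) A (P t) (Q t)) (geg k (a + 1) A (P t) (Q t))
          (geg k (a + 1 + 1) A (P t) (Q t)) (geg1 k (a + 1 + 1) A (P t) (Q t))
          (geg2 k (a + 1 + 1) A (P t) (Q t)) (INR k).
        intros G1 G0 L M N K Hk E1 E2.
        apply Rmult_eq_reg_l with (K + 1 + 1); [|assumption].
        (* Up to the factor 2a, the multiplicities K+2 of p' [G1] and (K+2)/2 of q' [G0] are split
           as 1 + (K+1) and 1 + K/2; Euler's identity supplies the second summands. *)
        transitivity (2 * a * (p' * G1 - q' * G0
          + p' * (2 * (a + 1) * (P t * L - Q t * M))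
          - q' / 2 * (2 * (a + 1) * (P t * M - Q t * N)))); [field; assumption|].
        rewrite <- E1, <- E2. field.
Qed.

Definition taylor (K : nat) (a A p q : R) : R := sum_lt K (fun k => geg k a A p q).

(* In [rem (K - 1)] and [rem (K - 2)] below, truncated subtraction is the right
   convention: Taylor polynomials of negative order vanish, and so does [taylor 0]. *)
Definition rem (K : nat) (a A p q : R) : R :=
  Rpower (A - 2 * p + q) (- a) - taylor K a A p q.

Lemma sum_geg1 K a A p q : sum_lt K (fun k => geg1 k a A p q) = taylor (K - 1) a A p q.
Proof. exact (sum_lt_pred K (fun k => geg k a A p q)). Qed.

Lemma sum_geg2 K a A p q : sum_lt K (fun k => geg2 k a A p q) = taylor (K - 2) a A p q.
Proof.
  etransitivity; [exact (sum_lt_pred K (fun k => geg1 k a A p q))|].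
  rewrite sum_geg1. f_equal; lia.
Qed.

(** The weights of p and q are 1 and 2, which is why their remainders have orders K-1 and K-2. This
    identity is what later lets the squared gradient of the base be reabsorbed into a lower
    exponent. *)
Lemma rem_mul K a A p q : 0 < A -> 0 < A - 2 * p + q ->
  A * rem K (a + 1) A p q - 2 * p * rem (K - 1) (a + 1) A p q
    + q * rem (K - 2) (a + 1) A p q = rem K a A p q.
Proof.
  intros HA HQ. unfold rem. rewrite <- (Rpower_mul_self (A - 2 * p + q) a HQ).
  rewrite <- sum_geg1, <- sum_geg2. unfold taylor.
  rewrite (sum_lt_ext K (fun k => geg k a A p q) (fun k => A * geg k (a + 1) A p q
    + ((- (2 * p)) * geg1 k (a + 1) A p q + q * geg2 k (a + 1) A p q))).
  - rewrite !sum_lt_plus, !sum_lt_scal. ring.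
  - intros k _. rewrite <- (geg_mul k a A p q HA). ring.
Qed.

Lemma rem_deriv K a A P Q t p' q' :
  0 < A - 2 * P t + Q t ->
  derivable_pt_lim P t p' -> derivable_pt_lim Q t q' ->
  derivable_pt_lim (fun u => rem K a A (P u) (Q u)) t
    (2 * a * rem (K - 1) (a + 1) A (P t) (Q t) * p'
     - a * rem (K - 2) (a + 1) A (P t) (Q t) * q').
Proof.
  intros H HP HQ.
  assert (DQ : derivable_pt_lim (fun u => A - 2 * P u + Q u) t (0 - 2 * p' + q')).
  { apply derivable_pt_lim_add; [|assumption]. apply derivable_pt_lim_sub.
    - apply derivable_pt_lim_cst.
    - now apply derivable_pt_lim_cmul. }
  pose proof (derivable_pt_lim_comp _ _ _ _ _ DQ (derivable_pt_lim_power _ (- a) H)) as DP.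
  eapply derivable_pt_lim_val.
  - apply derivable_pt_lim_sub.
    + exact DP.
    + apply derivable_pt_lim_sum_lt. intros k _. exact (geg_deriv k a A P Q t p' q' HP HQ).
  - unfold rem. rewrite <- sum_geg1, <- sum_geg2.
    rewrite (sum_lt_ext K _ (fun k => (2 * a * p') * geg1 k (a + 1) A (P t) (Q t)
      + (- (a * q')) * geg2 k (a + 1) A (P t) (Q t))) by (intros; ring).
    rewrite sum_lt_plus, !sum_lt_scal.
    replace (- a - 1) with (- (a + 1)) by ring. ring.
Qed.

(** * Bounds on the Taylor remainder *)

Lemma Rpower_pos x y : 0 < Rpower x y.
Proof. apply exp_pos. Qed.

Lemma Rpower_anti x y a : 0 <= a -> 0 < x -> x <= y -> Rpower y (- a) <= Rpower x (- a).
Proof.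
  intros Ha Hx Hxy. rewrite !Rpower_Ropp.
  apply Rinv_le_contravar; [apply Rpower_pos|]. apply Rle_Rpower_l; lra.
Qed.

(** The intended values are s = d^2, A = d^2 + r^2, p = d x_0, q = |x|^2, and t = |x|/d, the
    distance to the origin relative to that of the centre. Estimates in terms of s instead of A are
    uniform in the width r. *)
Definition near_pole (A s t p q : R) : Prop :=
  0 < s <= A /\ 0 <= t /\ Rabs p <= t * s /\ 0 <= q <= t ^ 2 * s.

Lemma two_term_bound s t p q G H u v a :
  0 < s -> 0 <= t -> Rabs p <= t * s -> 0 <= q <= t ^ 2 * s ->
  Rabs G <= u * Rpower s (- (a + 1)) -> Rabs H <= v * Rpower s (- (a + 1)) ->
  Rabs (p * G - q * H) <= (t * u + t ^ 2 * v) * Rpower s (- a).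
Proof.
  intros HS Ht Hp Hq HG HH. rewrite <- (Rpower_mul_self s a HS).
  unfold Rminus. eapply Rle_trans; [apply Rabs_triang|].
  rewrite Rabs_Ropp, !Rabs_mult.
  replace ((t * u + t ^ 2 * v) * (s * Rpower s (- (a + 1)))) with
    ((t * s) * (u * Rpower s (- (a + 1))) + (t ^ 2 * s) * (v * Rpower s (- (a + 1))))
    by ring.
  apply Rplus_le_compat; apply Rmult_le_compat; try apply Rabs_pos; try assumption.
  rewrite Rabs_right; lra.
Qed.

Lemma geg_bound k : forall a, 0 < a -> exists C, 0 <= C /\
  forall A s t p q, near_pole A s t p q ->
  Rabs (geg k a A p q) <= C * t ^ k * Rpower s (- a).
Proof.
  induction k as [k IH] using lt_wf_ind; intros a Ha.
  destruct k as [|k].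
  - exists 1. split; [lra|]. intros A s t p q (HS & _). simpl.
    rewrite Rabs_right by (apply Rle_ge, Rlt_le, Rpower_pos).
    replace (1 * 1 * Rpower s (- a)) with (Rpower s (- a)) by ring.
    apply Rpower_anti; lra.
  - assert (Hk : 0 < INR (S k)) by (apply lt_0_INR; lia).
    destruct (IH k ltac:(lia) (a + 1) ltac:(lra)) as (C1 & HC1 & B1).
    (* The factor t^2 stays on the left because [geg1] has order k-1: at k = 0 it vanishes, and a
       bound by t^(k-1) would need a negative power. *)
    assert (exists C, 0 <= C /\ forall A s t p q, near_pole A s t p q ->
      t ^ 2 * Rabs (geg1 k (a + 1) A p q) <= C * t * t ^ k * Rpower s (- (a + 1)))
      as (C2 & HC2 & B2).
    { destruct k as [|k].
      - exists 0. split; [lra|]. intros. simpl. rewrite Rabs_R0. lra.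
      - destruct (IH k ltac:(lia) (a + 1) ltac:(lra)) as (C2 & HC2 & B2).
        exists C2. split; [assumption|]. intros A s t p q H.
        specialize (B2 _ _ _ _ _ H). simpl geg1.
        replace (C2 * t * t ^ S k * Rpower s (- (a + 1))) with
          (t ^ 2 * (C2 * t ^ k * Rpower s (- (a + 1)))) by (simpl; ring).
        apply Rmult_le_compat_l; [apply pow2_ge_0|assumption]. }
    exists (2 * a / INR (S k) * (C1 + C2)).
    assert (H2a : 0 <= 2 * a / INR (S k))
      by (apply Rlt_le, Rdiv_lt_0_compat; lra).
    split; [apply Rmult_le_pos; lra|].
    intros A s t p q H.
    change (geg (S k) a A p q) with
      (2 * a / INR (S k) * (p * geg k (a + 1) A p q - q * geg1 k (a + 1) A p q)).
    rewrite Rabs_mult, (Rabs_right (2 * a / INR (S k))) by lra.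
    replace (2 * a / INR (S k) * (C1 + C2) * t ^ S k * Rpower s (- a)) with
      (2 * a / INR (S k) * ((C1 + C2) * t ^ S k * Rpower s (- a))) by ring.
    apply Rmult_le_compat_l; [assumption|].
    specialize (B1 _ _ _ _ _ H). specialize (B2 _ _ _ _ _ H).
    destruct H as (HS & Ht & Hp & Hq).
    unfold Rminus. eapply Rle_trans; [apply Rabs_triang|].
    rewrite Rabs_Ropp, !Rabs_mult, (Rabs_right q) by lra.
    assert (E1 : Rabs p * Rabs (geg k (a + 1) A p q)
      <= t * s * (C1 * t ^ k * Rpower s (- (a + 1)))).
    { apply Rmult_le_compat; try apply Rabs_pos; assumption. }
    assert (E2 : q * Rabs (geg1 k (a + 1) A p q)
      <= s * (C2 * t * t ^ k * Rpower s (- (a + 1)))).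
    { apply Rle_trans with ((t ^ 2 * s) * Rabs (geg1 k (a + 1) A p q)).
      - apply Rmult_le_compat_r; [apply Rabs_pos|lra].
      - replace (t ^ 2 * s * Rabs (geg1 k (a + 1) A p q)) with
          (s * (t ^ 2 * Rabs (geg1 k (a + 1) A p q))) by ring.
        apply Rmult_le_compat_l; [lra|assumption]. }
    rewrite <- (Rpower_mul_self s a) by lra. simpl pow.
    eapply Rle_trans; [apply Rplus_le_compat; eassumption|].
    apply Req_le; ring.
Qed.

(** Far from the origin, at t >= 1/4, a power t^k with k < K is at most 4^(K-k) t^K. The polynomial
    thus obeys a bound of the same form as the remainder does near the origin. *)
Lemma taylor_bound K a : 0 < a -> exists C, 0 <= C /\
  forall A s t p q, near_pole A s t p q -> 1 / 4 <= t ->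
  Rabs (taylor K a A p q) <= C * t ^ K * Rpower s (- a).
Proof.
  intros Ha. induction K as [|K (C & HC & B)].
  - exists 0. split; [lra|]. intros. unfold taylor; simpl. rewrite Rabs_R0. lra.
  - destruct (geg_bound K a Ha) as (C' & HC' & B').
    exists (4 * (C + C')). split; [lra|]. intros A s t p q H Ht.
    specialize (B _ _ _ _ _ H Ht). specialize (B' _ _ _ _ _ H).
    change (taylor (S K) a A p q) with (taylor K a A p q + geg K a A p q).
    eapply Rle_trans; [apply Rabs_triang|].
    eapply Rle_trans; [apply Rplus_le_compat; eassumption|].
    replace (4 * (C + C') * t ^ S K * Rpower s (- a)) with
      (4 * t * ((C + C') * t ^ K * Rpower s (- a))) by (simpl; ring).
    replace (C * t ^ K * Rpower s (- a) + C' * t ^ K * Rpower s (- a)) with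
      (1 * ((C + C') * t ^ K * Rpower s (- a))) by ring.
    apply Rmult_le_compat_r; [|lra].
    apply Rmult_le_pos; [|apply Rlt_le, Rpower_pos].
    apply Rmult_le_pos; [lra|apply pow_le; lra].
Qed.

Lemma near_pole_gap A s t p q :
  near_pole A s t p q -> t <= 1 / 4 -> s / 2 <= A - 2 * p + q.
Proof.
  intros (HS & Ht & Hp & Hq) Ht4. pose proof (Rle_abs p).
  assert (t * s <= 1 / 4 * s) by (apply Rmult_le_compat_r; lra). lra.
Qed.

Lemma geg_origin k a A : geg (S k) a A 0 0 = 0.
Proof. simpl geg. ring. Qed.

Lemma rem_origin K a A : rem (S K) a A 0 0 = 0.
Proof.
  unfold rem, taylor. replace (A - 2 * 0 + 0) with A by ring.
  induction K as [|K IH].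
  - simpl. ring.
  - simpl sum_lt in *. pose proof (geg_origin K a A) as E. lra.
Qed.

(* Integrating along the ray towards the origin, each order of the Taylor remainder
   gains a factor [t]. *)
Lemma rem_bound K : forall a, 0 < a -> exists C, 0 <= C /\
  forall A s t p q, near_pole A s t p q -> t <= 1 / 4 ->
  Rabs (rem K a A p q) <= C * t ^ K * Rpower s (- a).
Proof.
  induction K as [K IH] using lt_wf_ind; intros a Ha.
  destruct K as [|K].
  - exists (Rpower (1 / 2) (- a)). split; [apply Rlt_le, Rpower_pos|].
    intros A s t p q H Ht. pose proof (near_pole_gap _ _ _ _ _ H Ht) as G.
    destruct H as (HS & _).
    unfold rem, taylor; simpl.
    rewrite Rminus_0_r, Rabs_right by (apply Rle_ge, Rlt_le, Rpower_pos).
    rewrite Rmult_1_r, Rpower_mult_distr by lra.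
    replace (1 / 2 * s) with (s / 2) by field. apply Rpower_anti; lra.
  - destruct (IH K ltac:(lia) (a + 1) ltac:(lra)) as (C1 & HC1 & B1).
    destruct (IH (K - 1)%nat ltac:(lia) (a + 1) ltac:(lra)) as (C2 & HC2 & B2).
    exists (2 * a * (C1 + C2)).
    split; [apply Rmult_le_pos; lra|].
    intros A s t p q H Ht.
    (* Along the ray u x the variables p and q scale with u and u^2, and t remains an admissible
       bound for every u in [0, 1]. *)
    assert (HN : forall u, 0 <= u <= 1 -> near_pole A s t (u * p) (u ^ 2 * q)).
    { intros u Hu. destruct H as (HS & Ht0 & Hp & Hq). repeat split; try lra.
      - rewrite Rabs_mult, (Rabs_right u) by lra. pose proof (Rabs_pos p).
        apply Rle_trans with (1 * Rabs p); [apply Rmult_le_compat_r; lra|lra].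
      - apply Rmult_le_pos; [apply pow2_ge_0|lra].
      - apply Rle_trans with (1 * q); [|lra].
        apply Rmult_le_compat_r; [lra|]. nra. }
    destruct (MVT_cor2 (fun u => rem (S K) a A (u * p) (u ^ 2 * q))
      (fun u => 2 * a * rem K (a + 1) A (u * p) (u ^ 2 * q) * p
        - a * rem (K - 1) (a + 1) A (u * p) (u ^ 2 * q) * (2 * u * q)) 0 1)
      as (c & Hc & Hc01); [lra| |].
    { intros u Hu. pose proof (near_pole_gap _ _ _ _ _ (HN u Hu) Ht) as G.
      destruct H as (HS & _).
      pose proof (rem_deriv (S K) a A (fun u => u * p) (fun u => u ^ 2 * q) u p (2 * u * q))
        as D.
      replace (S K - 1)%nat with K in D by lia.
      replace (S K - 2)%nat with (K - 1)%nat in D by lia.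
      apply D; [lra| |].
      - eapply derivable_pt_lim_val.
        + apply derivable_pt_lim_mul; [apply derivable_pt_lim_id|apply derivable_pt_lim_cst].
        + unfold id; ring.
      - eapply derivable_pt_lim_val.
        + apply derivable_pt_lim_mul; [apply (derivable_pt_lim_pow u 2)|apply derivable_pt_lim_cst].
        + simpl; ring. }
    cbv beta in Hc.
    replace (0 * p) with 0 in Hc by ring. replace (0 ^ 2 * q) with 0 in Hc by ring.
    replace (1 * p) with p in Hc by ring. replace (1 ^ 2 * q) with q in Hc by ring.
    rewrite rem_origin in Hc.
    assert (Hc' : 0 <= c <= 1) by lra. clear Hc01.
    specialize (B1 _ _ _ _ _ (HN c Hc') Ht). specialize (B2 _ _ _ _ _ (HN c Hc') Ht).
    set (G := rem K (a + 1) A (c * p) (c ^ 2 * q)) in *.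
    set (L := rem (K - 1) (a + 1) A (c * p) (c ^ 2 * q)) in *.
    destruct H as (HS & Ht0 & Hp & Hq).
    replace (rem (S K) a A p q) with (2 * a * (p * G - q * (c * L))) by lra.
    rewrite Rabs_mult, (Rabs_right (2 * a)) by lra.
    replace (2 * a * (C1 + C2) * t ^ S K * Rpower s (- a)) with
      (2 * a * ((C1 + C2) * t ^ S K * Rpower s (- a))) by ring.
    apply Rmult_le_compat_l; [lra|].
    assert (HL : Rabs (c * L) <= (C2 * t ^ (K - 1)) * Rpower s (- (a + 1))).
    { rewrite Rabs_mult, (Rabs_right c) by lra. pose proof (Rabs_pos L).
      apply Rle_trans with (1 * Rabs L); [apply Rmult_le_compat_r; lra|lra]. }
    eapply Rle_trans.
    { eapply two_term_bound with (a := a) (t := t) (s := s);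
        [lra|lra|exact Hp|exact Hq|exact B1|exact HL]. }
    apply Rmult_le_compat_r; [apply Rlt_le, Rpower_pos|].
    (* An equality unless K = 0; there the truncated order K-1 is 0 and t <= 1/4 closes the gap. *)
    assert (t ^ 2 * t ^ (K - 1) <= t * t ^ K).
    { destruct K as [|K]; simpl.
      - nra.
      - rewrite Nat.sub_0_r. apply Req_le; ring. }
    simpl. nra.
Qed.

(** * Iterated Laplacians *)

Lemma upd_same x i t : upd x i t i = t.
Proof. unfold upd. now rewrite Nat.eqb_refl. Qed.

Lemma upd_other x i j t : j <> i -> upd x i t j = x j.
Proof. intros H. unfold upd. now rewrite (proj2 (Nat.eqb_neq j i) H). Qed.

Lemma upd_id x i : upd x i (x i) = x.
Proof.
  apply functional_extensionality; intros j. unfold upd.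
  destruct (Nat.eqb_spec j i); now subst.
Qed.

Lemma upd_upd x i t u : upd (upd x i t) i u = upd x i u.
Proof.
  apply functional_extensionality; intros j. unfold upd. now destruct (Nat.eqb j i).
Qed.

(** [partial] picks a value by [epsilon], which means something only where the derivative exists, so
    existence is carried along. Asking it at every point gives an equality of functions, which can
    be iterated. *)
Definition has_partial (i : nat) (f g : (nat -> R) -> R) : Prop :=
  forall x, derivable_pt_lim (fun t => f (upd x i t)) (x i) (g x).

Lemma partial_eq i f g : has_partial i f g -> partial i f = g.
Proof.
  intros H. apply functional_extensionality; intros x. unfold partial, deriv1.
  apply (uniqueness_limite (fun t => f (upd x i t)) (x i)); [|apply H].
  apply epsilon_spec. exists (g x). apply H.
Qed.

Lemma has_partial_line i f g x t :
  has_partial i f g -> derivable_pt_lim (fun u => f (upd x i u)) t (g (upd x i t)).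
Proof.
  intros H. specialize (H (upd x i t)). rewrite upd_same in H.
  intros eps Heps. destruct (H eps Heps) as [d Hd]. exists d. intros h h0 hd.
  specialize (Hd h h0 hd). now rewrite !upd_upd in Hd.
Qed.

Lemma has_partial_val i f g g' : has_partial i f g -> (forall x, g x = g' x) -> has_partial i f g'.
Proof. intros H E x. now rewrite <- E. Qed.

Lemma has_partial_add i f g f' g' :
  has_partial i f f' -> has_partial i g g' ->
  has_partial i (fun x => f x + g x) (fun x => f' x + g' x).
Proof.
  intros Hf Hg x.
  apply (derivable_pt_lim_add (fun t => f (upd x i t)) (fun t => g (upd x i t))); auto.
Qed.

Lemma has_partial_mul i f g f' g' :
  has_partial i f f' -> has_partial i g g' ->
  has_partial i (fun x => f x * g x) (fun x => f' x * g x + f x * g' x).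
Proof.
  intros Hf Hg x. eapply derivable_pt_lim_val.
  - apply (derivable_pt_lim_mul (fun t => f (upd x i t)) (fun t => g (upd x i t))); auto.
  - cbv beta. now rewrite upd_id.
Qed.

Lemma has_partial_const i c : has_partial i (fun _ => c) (fun _ => 0).
Proof. intros x. apply derivable_pt_lim_cst. Qed.

Lemma has_partial_scal i c f f' :
  has_partial i f f' -> has_partial i (fun x => c * f x) (fun x => c * f' x).
Proof. intros H x. apply (derivable_pt_lim_cmul c (fun t => f (upd x i t))). apply H. Qed.

Lemma has_partial_coord i k :
  has_partial i (fun x => x k) (fun _ => if Nat.eqb k i then 1 else 0).
Proof.
  intros x. destruct (Nat.eqb_spec k i) as [->|H].
  - intros eps Heps. destruct (derivable_pt_lim_id (x i) eps Heps) as [d Hd].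
    exists d. intros h h0 hd. rewrite !upd_same. exact (Hd h h0 hd).
  - intros eps Heps. destruct (derivable_pt_lim_cst (x k) (x i) eps Heps) as [d Hd].
    exists d. intros h h0 hd. rewrite !upd_other by assumption. exact (Hd h h0 hd).
Qed.

Definition sqn (n : nat) (x : nat -> R) : R := sum_lt n (fun j => x j ^ 2).

Lemma has_partial_sum_lt i n (F F' : nat -> (nat -> R) -> R) :
  (forall k, (k < n)%nat -> has_partial i (F k) (F' k)) ->
  has_partial i (fun x => sum_lt n (fun k => F k x)) (fun x => sum_lt n (fun k => F' k x)).
Proof.
  intros H x.
  apply (derivable_pt_lim_sum_lt n (fun k t => F k (upd x i t)) (fun k => F' k x)).
  intros k Hk. now apply H.
Qed.

Lemma sum_lt_single n i F :
  (i < n)%nat -> sum_lt n (fun k => if Nat.eqb k i then F k else 0) = F i.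
Proof.
  induction n as [|n IH]; intros Hi; [lia|]. simpl.
  destruct (Nat.eqb_spec n i) as [->|Hne].
  - rewrite (sum_lt_ext i _ (fun _ => 0)).
    + rewrite sum_lt_const; ring.
    + intros k Hk. destruct (Nat.eqb_spec k i); [lia|reflexivity].
  - rewrite IH by lia. ring.
Qed.

Lemma has_partial_sqn i n : (i < n)%nat -> has_partial i (sqn n) (fun x => 2 * x i).
Proof.
  intros Hi. eapply has_partial_val.
  - apply (has_partial_sum_lt i n (fun k x => x k ^ 2)
      (fun k x => if Nat.eqb k i then 2 * x k else 0)).
    intros k _. eapply has_partial_val.
    + apply (has_partial_mul i (fun x => x k) (fun x => x k * 1)
        (fun _ => if Nat.eqb k i then 1 else 0) (fun _ => if Nat.eqb k i then 1 else 0)).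
      * apply has_partial_coord.
      * eapply has_partial_val.
        -- apply has_partial_mul; [apply has_partial_coord|apply has_partial_const].
        -- intros x. simpl. destruct (Nat.eqb k i); ring.
    + intros x. simpl. destruct (Nat.eqb k i); ring.
  - intros x. cbv beta. exact (sum_lt_single n i (fun k => 2 * x k) Hi).
Qed.

Definition has_lap (n : nat) (f g : (nat -> R) -> R) : Prop :=
  exists f1 f2 : nat -> (nat -> R) -> R,
    (forall i, (i < n)%nat -> has_partial i f (f1 i) /\ has_partial i (f1 i) (f2 i)) /\
    forall x, g x = sum_lt n (fun i => f2 i x).

Lemma laplacian_eq n f g : has_lap n f g -> laplacian n f = g.
Proof.
  intros (f1 & f2 & H & E). apply functional_extensionality; intros x.
  rewrite E. unfold laplacian. apply sum_lt_ext. intros i Hi.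
  destruct (H i Hi) as [H1 H2].
  now rewrite (partial_eq _ _ _ H1), (partial_eq _ _ _ H2).
Qed.

Lemma has_lap_add n f g f' g' : has_lap n f f' -> has_lap n g g' ->
  has_lap n (fun x => f x + g x) (fun x => f' x + g' x).
Proof.
  intros (f1 & f2 & H & E) (g1 & g2 & H' & E').
  exists (fun i x => f1 i x + g1 i x), (fun i x => f2 i x + g2 i x). split.
  - intros i Hi. destruct (H i Hi), (H' i Hi). split; now apply has_partial_add.
  - intros x. now rewrite E, E', sum_lt_plus.
Qed.

Lemma has_lap_scal n c f f' : has_lap n f f' ->
  has_lap n (fun x => c * f x) (fun x => c * f' x).
Proof.
  intros (f1 & f2 & H & E).
  exists (fun i x => c * f1 i x), (fun i x => c * f2 i x). split.
  - intros i Hi. destruct (H i Hi). split; now apply has_partial_scal.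
  - intros x. now rewrite E, sum_lt_scal.
Qed.

Fixpoint has_lap_iter (k n : nat) (f g : (nat -> R) -> R) : Prop :=
  match k with
  | O => f = g
  | S k' => exists h, has_lap n f h /\ has_lap_iter k' n h g
  end.

Lemma iter_lap_eq k n : forall f g, has_lap_iter k n f g -> iter_lap k n f = g.
Proof.
  induction k as [|k IH]; intros f g H; [exact H|].
  destruct H as (h & H1 & H2). unfold iter_lap. rewrite Nat.iter_succ_r.
  rewrite (laplacian_eq _ _ _ H1). now apply IH.
Qed.

Lemma has_lap_iter_snoc k n : forall f g h,
  has_lap_iter k n f g -> has_lap n g h -> has_lap_iter (S k) n f h.
Proof.
  induction k as [|k IH]; intros f g h H1 H2.
  - simpl in H1. subst g. exists h. now split.
  - destruct H1 as (u & H1 & H3). exists u. split; [assumption|].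
    exact (IH _ _ _ H3 H2).
Qed.

Lemma has_lap_iter_add k n : forall f g f' g',
  has_lap_iter k n f f' -> has_lap_iter k n g g' ->
  has_lap_iter k n (fun x => f x + g x) (fun x => f' x + g' x).
Proof.
  induction k as [|k IH]; intros f g f' g' H H'.
  - simpl in *. now subst.
  - destruct H as (h & H1 & H2), H' as (h' & H1' & H2').
    exists (fun x => h x + h' x). split; [now apply has_lap_add|now apply IH].
Qed.

Lemma has_lap_iter_scal k n c : forall f f',
  has_lap_iter k n f f' -> has_lap_iter k n (fun x => c * f x) (fun x => c * f' x).
Proof.
  induction k as [|k IH]; intros f f' H.
  - simpl in *. now subst.
  - destruct H as (h & H1 & H2).
    exists (fun x => c * h x). split; [now apply has_lap_scal|now apply IH].
Qed.

Lemma has_lap_val n f g g' : has_lap n f g -> (forall x, g x = g' x) -> has_lap n f g'.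
Proof. intros H E. replace g' with g; [assumption|]. now apply functional_extensionality. Qed.

Lemma has_lap_iter_val k n f g g' :
  has_lap_iter k n f g -> (forall x, g x = g' x) -> has_lap_iter k n f g'.
Proof. intros H E. replace g' with g; [assumption|]. now apply functional_extensionality. Qed.

Lemma has_partial_sqn_pow i n k : (i < n)%nat ->
  has_partial i (fun x => sqn n x ^ k) (fun x => INR k * sqn n x ^ (k - 1) * (2 * x i)).
Proof.
  intros Hi x.
  pose proof (derivable_pt_lim_comp _ (fun y => y ^ k) _ _ _ (has_partial_sqn i n Hi x)
    (derivable_pt_lim_pow (sqn n (upd x i (x i))) k)) as D.
  rewrite upd_id in D. eapply derivable_pt_lim_val; [exact D|].
  rewrite Nat.sub_1_r. reflexivity.
Qed.

Lemma has_lap_sqn_pow n k :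
  has_lap n (fun x => sqn n x ^ k)
    (fun x => 2 * INR k * (2 * INR k + INR n - 2) * sqn n x ^ (k - 1)).
Proof.
  exists (fun i x => 2 * INR k * (x i * sqn n x ^ (k - 1))).
  exists (fun i x => 2 * INR k * (1 * sqn n x ^ (k - 1)
    + x i * (INR (k - 1) * sqn n x ^ (k - 1 - 1) * (2 * x i)))).
  split.
  - intros i Hi. split.
    + eapply has_partial_val; [apply has_partial_sqn_pow; assumption|].
      intros x; simpl; ring.
    + apply has_partial_scal. eapply has_partial_val.
      * apply has_partial_mul; [apply has_partial_coord|now apply has_partial_sqn_pow].
      * intros x. cbv beta. now rewrite Nat.eqb_refl.
  - intros x. rewrite sum_lt_scal, sum_lt_plus, sum_lt_const.
    rewrite (sum_lt_ext n _ (fun i => (2 * INR (k - 1) * sqn n x ^ (k - 1 - 1)) * (x i ^ 2)))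
      by (intros; ring).
    rewrite sum_lt_scal. fold (sqn n x).
    destruct k as [|[|k]].
    + simpl INR. ring.
    + simpl. ring.
    + replace (S (S k) - 1)%nat with (S k) by lia.
      replace (S k - 1)%nat with k by lia.
      rewrite !S_INR. simpl pow. ring.
Qed.

Lemma has_lap_iter_sqn_pow n k : forall j c, (j < k)%nat ->
  has_lap_iter k n (fun x => c * sqn n x ^ j) (fun _ => 0).
Proof.
  (* Zero is kept in the form [0 * sqn n x ^ 0], so that the power rule applies to it again. *)
  assert (Z : forall k, has_lap_iter k n (fun x => 0 * sqn n x ^ 0) (fun _ => 0)).
  { clear k. induction k as [|k IH].
    - apply functional_extensionality; intros; ring.
    - exists (fun x => 0 * sqn n x ^ 0). split; [|exact IH].
      eapply has_lap_val; [apply has_lap_scal, has_lap_sqn_pow|].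
      intros; simpl; ring. }
  induction k as [|k IH]; intros j c Hj; [lia|].
  destruct j as [|j].
  - exists (fun x => 0 * sqn n x ^ 0). split; [|apply Z].
    eapply has_lap_val; [apply has_lap_scal, has_lap_sqn_pow|].
    intros; simpl; ring.
  - exists (fun x => (c * (2 * INR (S j) * (2 * INR (S j) + INR n - 2))) * sqn n x ^ j).
    split; [|apply IH; lia].
    eapply has_lap_val; [apply has_lap_scal, has_lap_sqn_pow|].
    intros; cbv beta. replace (S j - 1)%nat with j by lia. ring.
Qed.

(** The base d^2 + r^2 - 2 d x_0 + |x|^2 is r^2 + |x - d e_0|^2. Since d x_0 and |x|^2 are
    homogeneous in x of degrees 1 and 2, [taylor K] becomes the Taylor polynomial of degree K-1 at
    the origin; K = 0 gives the bare bubble. *)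
Definition corrected_bubble (n K : nat) (a d r : R) (x : nat -> R) : R :=
  rem K a (d ^ 2 + r ^ 2) (d * x O) (sqn n x).

Lemma head_sq_le_sqn n x : (0 < n)%nat -> x O ^ 2 <= sqn n x.
Proof.
  intros Hn. apply (sum_lt_term_le n (fun j => x j ^ 2)); [|assumption].
  intros; apply pow2_ge_0.
Qed.

Lemma bubble_base_ge n d r x : (0 < n)%nat ->
  r ^ 2 <= d ^ 2 + r ^ 2 - 2 * (d * x O) + sqn n x.
Proof.
  intros Hn. pose proof (head_sq_le_sqn n x Hn).
  pose proof (pow2_ge_0 (d - x O)). nra.
Qed.

Lemma has_partial_corrected_bubble n i K a d r : (i < n)%nat -> 0 < r ->
  has_partial i (corrected_bubble n K a d r)
    (fun x => (2 * a * d * if Nat.eqb i 0 then 1 else 0) * corrected_bubble n (K - 1) (a + 1) d r x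
      + (- (2 * a)) * (x i * corrected_bubble n (K - 2) (a + 1) d r x)).
Proof.
  intros Hi Hr x. unfold corrected_bubble.
  pose proof (bubble_base_ge n d r x ltac:(lia)) as HQ.
  assert (0 < r ^ 2) by (apply pow_lt; assumption).
  eapply derivable_pt_lim_val.
  - apply (rem_deriv K a (d ^ 2 + r ^ 2) (fun t => d * upd x i t O) (fun t => sqn n (upd x i t))).
    + rewrite upd_id. lra.
    + apply derivable_pt_lim_cmul. apply has_partial_coord.
    + now apply has_partial_sqn.
  - cbv beta. rewrite upd_id, (Nat.eqb_sym 0 i). ring.
Qed.

(** For the bare power, the squared gradient of the base is four times (base - r^2); the factor base
    lowers the exponent a+2 to a+1, and r^2 leaves the second term. [rem_mul] is the form of this
    reduction that respects the truncation orders. *)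
Lemma has_lap_corrected_bubble n K a d r : (0 < n)%nat -> 0 < r ->
  has_lap n (corrected_bubble n K a d r)
    (fun x => (2 * a * (2 * a + 2 - INR n)) * corrected_bubble n (K - 2) (a + 1) d r x
      + (- (4 * a * (a + 1) * r ^ 2)) * corrected_bubble n (K - 2) (a + 2) d r x).
Proof.
  intros Hn Hr.
  set (N := fun K a => corrected_bubble n K a d r).
  set (e := fun i => if Nat.eqb i 0 then 1 else 0).
  exists (fun i x => (2 * a * d * e i) * N (K - 1)%nat (a + 1) x
    + (- (2 * a)) * (x i * N (K - 2)%nat (a + 1) x)).
  exists (fun i x => (2 * a * d * e i) * ((2 * (a + 1) * d * e i) * N (K - 2)%nat (a + 2) x
      + (- (2 * (a + 1))) * (x i * N (K - 3)%nat (a + 2) x))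
    + (- (2 * a)) * (1 * N (K - 2)%nat (a + 1) x
      + x i * ((2 * (a + 1) * d * e i) * N (K - 3)%nat (a + 2) x
        + (- (2 * (a + 1))) * (x i * N (K - 4)%nat (a + 2) x)))).
  split.
  - intros i Hi. split; [now apply has_partial_corrected_bubble|].
    assert (HD : forall l, has_partial i (N (K - l)%nat (a + 1))
      (fun x => (2 * (a + 1) * d * e i) * N (K - (l + 1))%nat (a + 2) x
        + (- (2 * (a + 1))) * (x i * N (K - (l + 2))%nat (a + 2) x))).
    { intros l. replace (a + 2) with (a + 1 + 1) by ring.
      replace (K - (l + 1))%nat with (K - l - 1)%nat by lia.
      replace (K - (l + 2))%nat with (K - l - 2)%nat by lia.
      now apply has_partial_corrected_bubble. }
    apply has_partial_add.
    + apply has_partial_scal. exact (HD 1%nat).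
    + apply has_partial_scal. eapply has_partial_val.
      * apply has_partial_mul; [apply has_partial_coord|exact (HD 2%nat)].
      * intros x. cbv beta. now rewrite Nat.eqb_refl.
  - intros x.
    rewrite (sum_lt_ext n _ (fun i =>
      ((if Nat.eqb i 0 then 4 * a * (a + 1) * d ^ 2 * N (K - 2)%nat (a + 2) x else 0) * 1
       + (if Nat.eqb i 0 then - (8 * a * (a + 1) * d * N (K - 3)%nat (a + 2) x) else 0) * x i)
      + ((- (2 * a) * N (K - 2)%nat (a + 1) x)
       + (4 * a * (a + 1) * N (K - 4)%nat (a + 2) x) * x i ^ 2))).
    + rewrite !sum_lt_plus, sum_lt_const, sum_lt_scal. fold (sqn n x).
      rewrite (sum_lt_head n _ (fun _ => 1)), (sum_lt_head n _ x) by assumption.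
      pose proof (bubble_base_ge n d r x Hn) as HQ.
      assert (Hr2 : 0 < r ^ 2) by (apply pow_lt; assumption).
      assert (HR2 : 0 <= d ^ 2) by apply pow2_ge_0.
      pose proof (rem_mul (K - 2) (a + 1) (d ^ 2 + r ^ 2) (d * x O) (sqn n x)
        ltac:(lra) ltac:(lra)) as E.
      replace (a + 1 + 1) with (a + 2) in E by ring.
      replace (K - 2 - 1)%nat with (K - 3)%nat in E by lia.
      replace (K - 2 - 2)%nat with (K - 4)%nat in E by lia.
      fold (corrected_bubble n (K - 2) (a + 2) d r x) in E.
      fold (corrected_bubble n (K - 3) (a + 2) d r x) in E.
      fold (corrected_bubble n (K - 4) (a + 2) d r x) in E.
      fold (corrected_bubble n (K - 2) (a + 1) d r x) in E.
      unfold N. rewrite <- E. ring.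
    + intros i _. unfold e. destruct (Nat.eqb i 0); ring.
Qed.

Fixpoint rising (a : R) (k : nat) : R :=
  match k with O => 1 | S k' => a * rising (a + 1) k' end.

Lemma rising_last k : forall a, rising a (S k) = rising a k * (a + INR k).
Proof.
  induction k as [|k IH]; intros a.
  - simpl. ring.
  - change (rising a (S (S k))) with (a * rising (a + 1) (S k)).
    rewrite IH, S_INR. simpl. ring.
Qed.

Lemma rising_pos k : forall a, 0 < a -> 0 < rising a k.
Proof.
  induction k as [|k IH]; intros a Ha; simpl; [lra|].
  apply Rmult_lt_0_compat; [assumption|apply IH; lra].
Qed.

(* Only at this exponent does the iterated Laplacian of the bubble collapse to a single
   power; the cross terms of two consecutive orders cancel. *)
Lemma has_lap_iter_corrected_bubble n d r m : (0 < n)%nat -> 0 < r -> forall K,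
  has_lap_iter m n (corrected_bubble n K (INR n / 2 - INR m) d r)
    (fun x => (- 4) ^ m * rising (INR n / 2 - INR m) (2 * m) * r ^ (2 * m)
      * corrected_bubble n (K - 2 * m) (INR n / 2 + INR m) d r x).
Proof.
  intros Hn Hr. induction m as [m IH] using lt_wf_ind; intros K.
  destruct m as [|[|m]].
  - apply functional_extensionality; intros x. simpl.
    rewrite Nat.sub_0_r, Rminus_0_r, Rplus_0_r. ring.
  - eexists. split; [apply has_lap_corrected_bubble; assumption|].
    apply functional_extensionality; intros x. simpl.
    replace (INR n / 2 - 1 + 2) with (INR n / 2 + 1) by ring. field.
  - eexists. split; [apply has_lap_corrected_bubble; assumption|].
    eapply has_lap_iter_val.
    + apply has_lap_iter_add; apply has_lap_iter_scal.
      * replace (INR n / 2 - INR (S (S m)) + 1) with (INR n / 2 - INR (S m))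
          by (rewrite !S_INR; ring).
        apply (IH (S m)); lia.
      * replace (INR n / 2 - INR (S (S m)) + 2) with (INR n / 2 - INR m)
          by (rewrite !S_INR; ring).
        (* The exponent a+2 belongs to two orders less, so the induction hypothesis accounts for all
           but one of the remaining Laplacians; the last is computed directly. *)
        eapply has_lap_iter_snoc; [apply (IH m); lia|].
        apply has_lap_scal, has_lap_corrected_bubble; assumption.
    + intros x. cbv beta.
      replace (K - 2 - 2 * S m)%nat with (K - 2 * S (S m))%nat by lia.
      replace (K - 2 - 2 * m - 2)%nat with (K - 2 * S (S m))%nat by lia.
      replace (2 * S (S m))%nat with (S (S (S (S (2 * m))))) by lia.
      replace (2 * S m)%nat with (S (S (2 * m))) by lia.
      replace (INR n / 2 + INR m + 1) with (INR n / 2 + INR (S m)) by (rewrite S_INR; ring).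
      replace (INR n / 2 + INR m + 2) with (INR n / 2 + INR (S (S m)))
        by (rewrite !S_INR; ring).
      set (h := INR n / 2). replace (INR n) with (2 * h) by (unfold h; field).
      assert (E1 : rising (h - INR (S m)) (S (S (2 * m)))
        = (h - INR m - 1) * (rising (h - INR m) (2 * m) * (h + INR m))).
      { replace (h - INR (S m)) with (h - INR m - 1) by (rewrite S_INR; ring).
        change (rising (h - INR m - 1) (S (S (2 * m)))) with
          ((h - INR m - 1) * rising (h - INR m - 1 + 1) (S (2 * m))).
        rewrite rising_last, mult_INR. replace (INR 2) with 2 by (simpl; ring).
        replace (h - INR m - 1 + 1) with (h - INR m) by ring. ring. }
      assert (E2 : rising (h - INR (S (S m))) (S (S (S (S (2 * m)))))
        = (h - INR m - 2) * ((h - INR m - 1)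
          * (rising (h - INR m) (2 * m) * (h + INR m) * (h + INR m + 1)))).
      { replace (h - INR (S (S m))) with (h - INR m - 2) by (rewrite !S_INR; ring).
        change (rising (h - INR m - 2) (S (S (S (S (2 * m)))))) with
          ((h - INR m - 2) * ((h - INR m - 2 + 1) * rising (h - INR m - 2 + 1 + 1) (S (S (2 * m))))).
        rewrite !rising_last, S_INR, mult_INR. replace (INR 2) with 2 by (simpl; ring).
        replace (h - INR m - 2 + 1 + 1) with (h - INR m) by ring. ring. }
      rewrite E1, E2, !S_INR. simpl pow. ring.
Qed.

(** * Series of functions on R^n *)

Lemma series_dominated a b : (forall j, Rabs (a j) <= b j) -> ex_series b ->
  ex_series a /\ Rabs (Series a) <= Series b.
Proof.
  intros H Hb.
  assert (HA : ex_series (fun j => Rabs (a j))).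
  { apply (ex_series_le (K := R_AbsRing) (V := R_CompleteNormedModule)) with b; [|assumption].
    intros j. change (Rabs (Rabs (a j)) <= b j). now rewrite Rabs_Rabsolu. }
  split; [now apply ex_series_Rabs|].
  eapply Rle_trans; [now apply Series_Rabs|].
  apply Series_le; [|assumption]. intros j. split; [apply Rabs_pos|apply H].
Qed.

Definition summable_on_balls (n : nat) (W : nat -> (nat -> R) -> R) : Prop :=
  forall rho, 0 <= rho -> exists b : nat -> R, ex_series b /\
    forall j x, sqn n x <= rho ^ 2 -> Rabs (W j x) <= b j.

Definition total (W : nat -> (nat -> R) -> R) (x : nat -> R) : R :=
  Series (fun j => W j x).

Lemma sqn_nonneg n x : 0 <= sqn n x.
Proof. apply sum_lt_nonneg. intros; apply pow2_ge_0. Qed.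

Lemma summable_at n W x : summable_on_balls n W -> ex_series (fun j => W j x).
Proof.
  intros H. destruct (H (sqrt (sqn n x)) (sqrt_pos _)) as (b & Hb & B).
  apply (series_dominated (fun j => W j x) b); [|assumption].
  intros j. apply B. rewrite pow2_sqrt by apply sqn_nonneg. lra.
Qed.

Lemma sqn_upd_le n x i t : (i < n)%nat -> sqn n (upd x i t) <= sqn n x + t ^ 2.
Proof.
  intros Hi. unfold sqn.
  rewrite <- (sum_lt_single n i (fun _ => t ^ 2) Hi), <- sum_lt_plus.
  apply sum_lt_le. intros k _. unfold upd. pose proof (pow2_ge_0 (x k)).
  destruct (Nat.eqb k i); lra.
Qed.

(** Two applications of the mean value theorem replace Taylor's formula; the lost factor 1/2 is
    harmless. A bound quadratic in d, with M free of d, is what can be summed over a series. *)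
Lemma quadratic_remainder f g h x i d M :
  has_partial i f g -> has_partial i g h ->
  (forall t, Rabs (t - x i) <= Rabs d -> Rabs (h (upd x i t)) <= M) ->
  Rabs (f (upd x i (x i + d)) - f x - d * g x) <= d ^ 2 * M.
Proof.
  intros Hf Hg HM.
  assert (Hin : forall c, Rmin (x i) (x i + d) <= c <= Rmax (x i) (x i + d) ->
    Rabs (c - x i) <= Rabs d).
  { intros c. unfold Rmin, Rmax. destruct (Rle_dec (x i) (x i + d)); intros Hc;
      unfold Rabs; destruct (Rcase_abs (c - x i)); destruct (Rcase_abs d); lra. }
  destruct (MVT_abs (fun t => f (upd x i t) - (t - x i) * g x)
    (fun t => g (upd x i t) - g x) (x i) (x i + d)) as (c & Ec & Hc).
  { intros t _. apply derivable_pt_lim_sub; [now apply has_partial_line|].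
    eapply derivable_pt_lim_val.
    - apply (derivable_pt_lim_mul (fun t => t - x i) (fun _ => g x)).
      + apply derivable_pt_lim_sub; [apply derivable_pt_lim_id|apply derivable_pt_lim_cst].
      + apply derivable_pt_lim_cst.
    - ring. }
  rewrite upd_id in Ec.
  replace (x i + d - x i) with d in Ec by ring.
  replace (f (upd x i (x i + d)) - d * g x - (f x - (x i - x i) * g x)) with
    (f (upd x i (x i + d)) - f x - d * g x) in Ec by ring.
  rewrite Ec.
  destruct (MVT_abs (fun t => g (upd x i t)) (fun t => h (upd x i t)) (x i) c)
    as (c' & Ec' & Hc').
  { intros t _. now apply has_partial_line. }
  rewrite upd_id in Ec'. rewrite Ec'.
  assert (Hc1 := Hin c Hc).
  assert (Hc2 : Rabs (c' - x i) <= Rabs d).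
  { revert Hc1. revert Hc'. unfold Rmin, Rmax. destruct (Rle_dec (x i) c); intros Hc';
      unfold Rabs; destruct (Rcase_abs (c - x i)); destruct (Rcase_abs (c' - x i));
      destruct (Rcase_abs d); lra. }
  rewrite <- (pow2_abs d). simpl pow. rewrite Rmult_1_r.
  pose proof (Rabs_pos d). pose proof (Rabs_pos (c - x i)).
  assert (0 <= Rabs (h (upd x i c'))) by apply Rabs_pos.
  specialize (HM c' Hc2).
  apply Rle_trans with (M * Rabs d * Rabs d); [|apply Req_le; ring].
  apply Rmult_le_compat_r; [assumption|].
  apply Rmult_le_compat; assumption.
Qed.

(** The quadratic errors of the terms add up to h^2 [Series b], which is o(h). The price is control
    of second derivatives, at no cost for a class closed under differentiation. *)
Lemma has_partial_total n i W W1 W2 : (i < n)%nat ->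
  summable_on_balls n W -> summable_on_balls n W1 -> summable_on_balls n W2 ->
  (forall j, has_partial i (W j) (W1 j)) -> (forall j, has_partial i (W1 j) (W2 j)) ->
  has_partial i (total W) (total W1).
Proof.
  intros Hi S0 S1 S2 H1 H2 x.
  (* This ball contains x and all points obtained by moving its i-th coordinate by at most 1. *)
  set (rho := sqrt (sqn n x + (Rabs (x i) + 1) ^ 2)).
  destruct (S2 rho (sqrt_pos _)) as (b & Hb & B).
  assert (Hrho : forall t, Rabs (t - x i) <= 1 -> sqn n (upd x i t) <= rho ^ 2).
  { intros t Ht. unfold rho. pose proof (sqn_nonneg n x).
    pose proof (pow2_ge_0 (Rabs (x i) + 1)). rewrite pow2_sqrt by lra.
    eapply Rle_trans; [now apply sqn_upd_le|]. apply Rplus_le_compat_l.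
    rewrite <- (pow2_abs t). apply pow_incr. split; [apply Rabs_pos|].
    pose proof (Rabs_triang_inv t (x i)). lra. }
  assert (Hb0 : 0 <= Series b).
  { eapply Rle_trans; [apply Rabs_pos|].
    apply (series_dominated (fun j => W2 j x) b); [|assumption].
    intros j. apply B. rewrite <- (upd_id x i) at 1. apply Hrho.
    replace (x i - x i) with 0 by ring. rewrite Rabs_R0; lra. }
  assert (Key : forall h, Rabs h <= 1 ->
    Rabs (total W (upd x i (x i + h)) - total W x - h * total W1 x) <= h ^ 2 * Series b).
  { intros h Hh.
    pose proof (summable_at n W (upd x i (x i + h)) S0) as X1.
    pose proof (summable_at n W x S0) as X2.
    pose proof (summable_at n W1 x S1) as X3.
    assert (X4 : ex_series (fun j => h * W1 j x)) by exact (ex_series_scal_l h _ X3).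
    assert (X5 : ex_series (fun j => W j (upd x i (x i + h)) - W j x))
      by exact (ex_series_minus _ _ X1 X2).
    unfold total.
    rewrite <- Series_scal_l, <- (Series_minus _ _ X1 X2).
    rewrite <- (Series_minus _ _ X5 X4), <- Series_scal_l.
    apply series_dominated.
    - intros j. apply (quadratic_remainder (W j) (W1 j) (W2 j)); auto.
      intros t Ht. apply B, Hrho. lra.
    - exact (ex_series_scal_l (h ^ 2) b Hb). }
  intros eps Heps.
  assert (Hd : 0 < Rmin 1 (eps / (Series b + 1))).
  { apply Rmin_pos; [lra|]. apply Rdiv_lt_0_compat; lra. }
  exists (mkposreal _ Hd). simpl. intros h h0 hd.
  pose proof (Rmin_l 1 (eps / (Series b + 1))). pose proof (Rmin_r 1 (eps / (Series b + 1))).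
  specialize (Key h ltac:(lra)). rewrite upd_id.
  replace ((total W (upd x i (x i + h)) - total W x) / h - total W1 x) with
    ((total W (upd x i (x i + h)) - total W x - h * total W1 x) / h) by (field; assumption).
  unfold Rdiv at 1. rewrite Rabs_mult, Rabs_inv.
  assert (Hpos : 0 < Rabs h) by now apply Rabs_pos_lt.
  apply Rmult_lt_reg_r with (Rabs h); [assumption|].
  rewrite Rmult_assoc, Rinv_l, Rmult_1_r by lra.
  eapply Rle_lt_trans; [exact Key|]. rewrite <- (pow2_abs h).
  replace (Rabs h ^ 2 * Series b) with (Rabs h * Series b * Rabs h) by ring.
  apply Rmult_lt_compat_r; [assumption|].
  apply Rle_lt_trans with (Rabs h * (Series b + 1)); [nra|].
  apply Rlt_le_trans with (eps / (Series b + 1) * (Series b + 1)).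
  - apply Rmult_lt_compat_r; lra.
  - apply Req_le. field. lra.
Qed.

(** * Continuity from locally bounded partial derivatives *)

Definition mix (k : nat) (x y : nat -> R) : nat -> R := fun j => if (j <? k)%nat then y j else x j.

Lemma mix_0 x y : mix 0 x y = x.
Proof. reflexivity. Qed.

Lemma mix_succ k x y : mix (S k) x y = upd (mix k x y) k (y k).
Proof.
  apply functional_extensionality; intros j. unfold mix, upd.
  destruct (Nat.eqb_spec j k) as [E|H].
  - rewrite E. destruct (Nat.ltb_spec k (S k)); [reflexivity|lia].
  - destruct (Nat.ltb_spec j (S k)), (Nat.ltb_spec j k); (reflexivity || lia).
Qed.

Lemma mix_coord k x y : mix k x y k = x k.
Proof. unfold mix. destruct (Nat.ltb_spec k k); [lia|reflexivity]. Qed.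

Lemma sqn_mix_le n k x y : sqn n (mix k x y) <= sqn n x + sqn n y.
Proof.
  unfold sqn. rewrite <- sum_lt_plus. apply sum_lt_le. intros i _. unfold mix.
  pose proof (pow2_ge_0 (x i)). pose proof (pow2_ge_0 (y i)). destruct (i <? k)%nat; lra.
Qed.

Lemma normn_sq n x : normn n x ^ 2 = sqn n x.
Proof. unfold normn. apply pow2_sqrt. apply sqn_nonneg. Qed.

Lemma coord_le_normn n x i : (i < n)%nat -> Rabs (x i) <= normn n x.
Proof.
  intros Hi. rewrite <- sqrt_Rsqr_abs. apply sqrt_le_1_alt. rewrite Rsqr_pow2.
  apply (sum_lt_term_le n (fun j => x j ^ 2)); [|assumption]. intros; apply pow2_ge_0.
Qed.

Lemma sqn_close n x y : sqn n y <= 2 * sqn n x + 2 * distn n x y ^ 2.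
Proof.
  unfold distn. rewrite normn_sq. unfold sqn. rewrite <- !sum_lt_scal, <- sum_lt_plus.
  apply sum_lt_le. intros i _. pose proof (pow2_ge_0 (2 * x i - y i)). nra.
Qed.

Lemma upd_increment_bound i f g x t M :
  has_partial i f g ->
  (forall u, Rmin (x i) t <= u <= Rmax (x i) t -> Rabs (g (upd x i u)) <= M) ->
  Rabs (f (upd x i t) - f x) <= M * Rabs (t - x i).
Proof.
  intros H HM.
  destruct (MVT_abs (fun u => f (upd x i u)) (fun u => g (upd x i u)) (x i) t)
    as (c & Ec & Hc).
  { intros u _. now apply has_partial_line. }
  rewrite upd_id in Ec. rewrite Ec. apply Rmult_le_compat_r; [apply Rabs_pos|auto].
Qed.

(** The increment is telescoped along a path changing one coordinate at a time. Such a path may meet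
    the origin, so derivatives and bounds are required on full balls. *)
Lemma cont_of_bounded_partials n f (g : nat -> (nat -> R) -> R) :
  (forall i, (i < n)%nat -> has_partial i f (g i)) ->
  (forall rho, 0 <= rho -> exists M, forall i x, (i < n)%nat -> sqn n x <= rho ^ 2 ->
    Rabs (g i x) <= M) ->
  cont_punct n f.
Proof.
  intros Hf Hg x [Hx _] eps Heps.
  (* With |y|^2 <= 2|x|^2 + 2, a corner of the path has square norm at most 3|x|^2 + 2, and the
     moving coordinate adds at most as much again. *)
  set (rho := sqrt (4 * (3 * sqn n x + 2))).
  pose proof (sqn_nonneg n x) as Hx0.
  assert (Hrho : rho ^ 2 = 4 * (3 * sqn n x + 2)) by (unfold rho; apply pow2_sqrt; lra).
  destruct (Hg rho (sqrt_pos _)) as (M0 & HM0).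
  set (M := Rabs M0 + 1).
  assert (HM1 : 1 <= M) by (unfold M; pose proof (Rabs_pos M0); lra).
  assert (HM : forall i z, (i < n)%nat -> sqn n z <= rho ^ 2 -> Rabs (g i z) <= M).
  { intros i z Hi Hz. specialize (HM0 i z Hi Hz). unfold M. pose proof (Rle_abs M0). lra. }
  assert (Hn1 : 0 < INR n + 1) by (pose proof (pos_INR n); lra).
  exists (Rmin 1 (eps / (M * (INR n + 1)))).
  assert (HP : 0 < M * (INR n + 1)) by (apply Rmult_lt_0_compat; lra).
  split; [apply Rmin_pos; [lra|now apply Rdiv_lt_0_compat]|].
  intros y [Hy _] Hd.
  pose proof (Rmin_l 1 (eps / (M * (INR n + 1)))).
  pose proof (Rmin_r 1 (eps / (M * (INR n + 1)))).
  set (D := distn n x y) in *.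
  assert (HD0 : 0 <= D) by apply sqrt_pos.
  assert (Hyn : sqn n y <= 2 * sqn n x + 2).
  { eapply Rle_trans; [apply (sqn_close n x y)|]. fold D. nra. }
  assert (Step : forall k, (k <= n)%nat ->
    Rabs (f (mix k x y) - f x) <= INR k * (M * D)).
  { induction k as [|k IH]; intros Hk.
    - rewrite mix_0. replace (f x - f x) with 0 by ring. rewrite Rabs_R0. simpl. lra.
    - specialize (IH ltac:(lia)).
      replace (f (mix (S k) x y) - f x) with
        ((f (mix (S k) x y) - f (mix k x y)) + (f (mix k x y) - f x)) by ring.
      eapply Rle_trans; [apply Rabs_triang|].
      rewrite S_INR. replace ((INR k + 1) * (M * D)) with (M * D + INR k * (M * D)) by ring.
      apply Rplus_le_compat; [|assumption].
      rewrite mix_succ. eapply Rle_trans.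
      + apply upd_increment_bound with (g := g k) (M := M); [apply Hf; lia|].
        intros u Hu. apply HM; [lia|]. rewrite Hrho.
        eapply Rle_trans; [apply sqn_upd_le; lia|].
        pose proof (sqn_mix_le n k x y). rewrite mix_coord in Hu.
        assert (Hxk : x k ^ 2 <= sqn n x)
          by (apply (sum_lt_term_le n (fun j => x j ^ 2)); [intros; apply pow2_ge_0|lia]).
        assert (Hyk : y k ^ 2 <= sqn n y)
          by (apply (sum_lt_term_le n (fun j => y j ^ 2)); [intros; apply pow2_ge_0|lia]).
        assert (u ^ 2 <= x k ^ 2 + y k ^ 2).
        { revert Hu. unfold Rmin, Rmax. destruct (Rle_dec (x k) (y k)); intros Hu;
            destruct (Rle_lt_dec 0 u); nra. }
        lra.
      + rewrite mix_coord. apply Rmult_le_compat_l; [lra|].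
        rewrite Rabs_minus_sym.
        apply (coord_le_normn n (fun j => x j - y j)). lia. }
  specialize (Step n (le_n n)).
  (* The path ends at y because coordinates from n on vanish for both points. *)
  replace (mix n x y) with y in Step.
  2:{ apply functional_extensionality; intros j. unfold mix.
      destruct (Nat.ltb_spec j n) as [L|L]; [reflexivity|]. now rewrite Hx, Hy. }
  eapply Rle_lt_trans; [exact Step|].
  assert (0 <= M * D) by (apply Rmult_le_pos; lra).
  apply Rle_lt_trans with (M * (INR n + 1) * D);
    [replace (M * (INR n + 1) * D) with (INR n * (M * D) + M * D) by ring; lra|].
  apply Rlt_le_trans with (M * (INR n + 1) * (eps / (M * (INR n + 1)))).
  - apply Rmult_lt_compat_l; lra.
  - apply Req_le. field. lra.
Qed.

(** * Families of corrected bubbles *)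

(* The bound on [c] makes [c j * corrected_bubble] of order [(1/2)^j] on every fixed ball:
   near the origin the remainder is of order [d^(-K-2a)]. *)
Inductive bubble_family (n : nat) (d r : nat -> R) : (nat -> (nat -> R) -> R) -> Prop :=
| family_const c : bubble_family n d r (fun j _ => c * (1 / 2) ^ j)
| family_coord i W : (i < n)%nat -> bubble_family n d r W -> bubble_family n d r (fun j x => x i * W j x)
| family_add W W' : bubble_family n d r W -> bubble_family n d r W' ->
    bubble_family n d r (fun j x => W j x + W' j x)
| family_bubble K a c C : 0 < a ->
    (forall j, Rabs (c j) * Rpower (d j ^ 2) (- a) <= C * (1 / 2) ^ j * d j ^ K) ->
    bubble_family n d r (fun j x => c j * corrected_bubble n K a (d j) (r j) x).

Lemma family_val n d r W W' :
  bubble_family n d r W -> (forall j x, W j x = W' j x) -> bubble_family n d r W'.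
Proof.
  intros H E. replace W' with W; [assumption|].
  apply functional_extensionality; intros j. apply functional_extensionality; intros x. auto.
Qed.

Lemma half_pow_pos j : 0 < (1 / 2) ^ j.
Proof. apply pow_lt; lra. Qed.

Lemma ex_series_half : ex_series (fun j => (1 / 2) ^ j).
Proof. apply ex_series_geom. rewrite Rabs_right; lra. Qed.

Lemma divide_by_scale d Y C K : 1 <= d -> 0 <= Y -> Y * d <= C * d ^ K -> Y <= C * d ^ (K - 1).
Proof.
  intros Hd HY H. destruct K as [|K]; simpl in *.
  - nra.
  - rewrite Nat.sub_0_r. apply Rmult_le_reg_r with d; [lra|].
    eapply Rle_trans; [exact H|]. apply Req_le; ring.
Qed.

(** The class allows coefficients up to C 2^(-j) d^(K+2a). Differentiation produces a coefficient of
    order c d at (K-1, a+1), where the limit has gained a factor d, and of order c at (K-2, a+1),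
    where it is unchanged. Where K-1 or K-2 is truncated, d >= 1 makes the limit only more
    generous. *)
Lemma family_partial n d r W i :
  (forall j, 1 <= d j) -> (forall j, 0 < r j) -> (i < n)%nat -> bubble_family n d r W ->
  exists W', bubble_family n d r W' /\ forall j, has_partial i (W j) (W' j).
Proof.
  intros Hd Hr Hi H.
  induction H as [c|k W Hk HW (W' & F & D)|W1 W2 H1 (W1' & F1 & D1) H2 (W2' & F2 & D2)
    |K a c C Ha HC].
  - exists (fun j _ => 0 * (1 / 2) ^ j). split; [constructor|].
    intros j. eapply has_partial_val; [apply has_partial_const|]. intros; simpl; ring.
  - destruct (Nat.eqb_spec k i) as [E|E].
    + exists (fun j x => W j x + x k * W' j x). split.
      * apply family_add; [assumption|]. now apply family_coord.
      * intros j. eapply has_partial_val.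
        -- apply has_partial_mul; [apply has_partial_coord|apply D].
        -- intros x. cbv beta. rewrite (proj2 (Nat.eqb_eq k i) E). ring.
    + exists (fun j x => x k * W' j x). split; [now apply family_coord|].
      intros j. eapply has_partial_val.
      * apply has_partial_mul; [apply has_partial_coord|apply D].
      * intros x. cbv beta. rewrite (proj2 (Nat.eqb_neq k i) E). ring.
  - exists (fun j x => W1' j x + W2' j x). split; [now apply family_add|].
    intros j. now apply has_partial_add.
  - set (e := if Nat.eqb i 0 then 1 else 0).
    assert (He : 0 <= e <= 1) by (unfold e; destruct (Nat.eqb i 0); lra).
    exists (fun j x =>
      (2 * a * d j * e * c j) * corrected_bubble n (K - 1) (a + 1) (d j) (r j) x
      + x i * ((- (2 * a) * c j) * corrected_bubble n (K - 2) (a + 1) (d j) (r j) x)).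
    assert (B1 : forall j, Rabs (c j) * Rpower (d j ^ 2) (- (a + 1)) * d j
      <= C * (1 / 2) ^ j * d j ^ (K - 1)).
    { intros j. specialize (Hd j). specialize (HC j).
      assert (0 <= Rabs (c j) * Rpower (d j ^ 2) (- (a + 1)))
        by (apply Rmult_le_pos; [apply Rabs_pos|apply Rlt_le, Rpower_pos]).
      apply divide_by_scale; [assumption|apply Rmult_le_pos; lra|].
      rewrite <- (Rpower_mul_self (d j ^ 2) a) in HC by (apply pow_lt; lra).
      eapply Rle_trans; [|exact HC]. apply Req_le; ring. }
    assert (B2 : forall j, Rabs (c j) * Rpower (d j ^ 2) (- (a + 1))
      <= C * (1 / 2) ^ j * d j ^ (K - 2)).
    { intros j. replace (K - 2)%nat with (K - 1 - 1)%nat by lia.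
      apply divide_by_scale; [apply Hd| |apply B1].
      apply Rmult_le_pos; [apply Rabs_pos|apply Rlt_le, Rpower_pos]. }
    split.
    + apply family_add; [|apply family_coord; [assumption|]].
      * apply family_bubble with (C := 2 * a * C); [lra|]. intros j.
        specialize (Hd j). rewrite !Rabs_mult.
        rewrite (Rabs_right 2), (Rabs_right a), (Rabs_right (d j)), (Rabs_right e) by lra.
        specialize (B1 j).
        set (X := Rabs (c j) * Rpower (d j ^ 2) (- (a + 1)) * d j) in *.
        assert (HX : 0 <= X).
        { unfold X. repeat apply Rmult_le_pos; try lra; [apply Rabs_pos|apply Rlt_le, Rpower_pos]. }
        replace (2 * a * d j * e * Rabs (c j) * Rpower (d j ^ 2) (- (a + 1)))
          with (2 * a * (e * X)) by (unfold X; ring).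
        replace (2 * a * C * (1 / 2) ^ j * d j ^ (K - 1)) with
          (2 * a * (C * (1 / 2) ^ j * d j ^ (K - 1))) by ring.
        apply Rmult_le_compat_l; [lra|]. nra.
      * apply family_bubble with (C := 2 * a * C); [lra|]. intros j.
        rewrite Rabs_mult, Rabs_Ropp, (Rabs_right (2 * a)) by lra.
        rewrite !Rmult_assoc. do 2 (apply Rmult_le_compat_l; [lra|]).
        rewrite <- !Rmult_assoc. apply B2.
    + intros j. eapply has_partial_val.
      * apply has_partial_scal, has_partial_corrected_bubble; auto.
      * intros x. cbv beta. fold e. ring.
Qed.

Lemma corrected_bubble_near_pole n d r x : (0 < n)%nat -> 0 < d ->
  near_pole (d ^ 2 + r ^ 2) (d ^ 2) (normn n x / d) (d * x O) (sqn n x).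
Proof.
  intros Hn Hd. pose proof (pow2_ge_0 r). assert (0 < d ^ 2) by (apply pow_lt; assumption).
  repeat split; try lra.
  - apply Rle_mult_inv_pos; [apply sqrt_pos|assumption].
  - rewrite Rabs_mult, (Rabs_right d) by lra.
    replace (normn n x / d * d ^ 2) with (d * normn n x) by (field; lra).
    apply Rmult_le_compat_l; [lra|now apply coord_le_normn].
  - apply sqn_nonneg.
  - rewrite <- normn_sq. apply Req_le. field. lra.
Qed.

Lemma ex_series_eventually_zero (b : nat -> R) N :
  (forall j, (N <= j)%nat -> b j = 0) -> ex_series b.
Proof.
  intros H. apply (ex_series_incr_n b N).
  apply ex_series_ext with (fun _ => 0 * (1 / 2) ^ 0).
  - intros j. rewrite H by lia. simpl; ring.
  - apply ex_series_ext with (fun j => 0 * (1 / 2) ^ j).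
    + intros j. simpl; ring.
    + exact (ex_series_scal_l 0 _ ex_series_half).
Qed.

Lemma bubble_pow_le n K a d r x : (0 < n)%nat -> 0 < a -> 0 < r ->
  0 <= corrected_bubble n K a d r x + taylor K a (d ^ 2 + r ^ 2) (d * x O) (sqn n x)
    <= Rpower (r ^ 2) (- a).
Proof.
  intros Hn Ha Hr. unfold corrected_bubble, rem.
  pose proof (bubble_base_ge n d r x Hn).
  match goal with |- 0 <= ?P - ?T + ?T <= _ => replace (P - T + T) with P by ring end.
  split; [apply Rlt_le, Rpower_pos|].
  apply Rpower_anti; [lra|now apply pow_lt|assumption].
Qed.

Lemma summable_bubble n d r K a c C : (0 < n)%nat ->
  (forall j, INR j + 1 <= d j) -> (forall j, 0 < r j) -> 0 < a ->
  (forall j, Rabs (c j) * Rpower (d j ^ 2) (- a) <= C * (1 / 2) ^ j * d j ^ K) ->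
  summable_on_balls n (fun j x => c j * corrected_bubble n K a (d j) (r j) x).
Proof.
  intros Hn Hd Hr Ha HC rho Hrho.
  destruct (rem_bound K a Ha) as (C1 & HC1 & B1).
  destruct (taylor_bound K a Ha) as (C2 & HC2 & B2).
  set (u := fun j => C * (C1 + C2) * rho ^ K * (1 / 2) ^ j).
  (* On the ball, t > 1/4 is possible only for the finitely many j with d_j <= 4 rho. For these [w]
     bounds the bare bubble by its peak; [u] takes care of remainders and Taylor polynomials. *)
  set (w := fun j => if Rlt_dec (4 * rho) (d j) then 0 else Rabs (c j) * Rpower (r j ^ 2) (- a)).
  exists (fun j => u j + w j). split.
  - apply (ex_series_plus u w).
    + exact (ex_series_scal_l _ _ ex_series_half).
    + destruct (INR_unbounded (4 * rho)) as (N & HN).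
      apply ex_series_eventually_zero with N. intros j Hj. unfold w.
      destruct (Rlt_dec (4 * rho) (d j)) as [L|L]; [reflexivity|].
      exfalso. apply L. specialize (Hd j). apply le_INR in Hj. lra.
  - intros j x Hx. specialize (Hd j). specialize (HC j). pose proof (pos_INR j).
    assert (Hd0 : 0 < d j) by lra.
    pose proof (corrected_bubble_near_pole n (d j) (r j) x Hn Hd0) as NP.
    set (t := normn n x / d j) in *.
    assert (Ht0 : 0 <= t) by apply NP.
    assert (Hx' : normn n x <= rho).
    { apply Rsqr_incr_0_var; [|assumption]. rewrite !Rsqr_pow2, normn_sq. assumption. }
    assert (Htd : t * d j = normn n x) by (unfold t; field; lra).
    assert (Hw : 0 <= w j).
    { unfold w. destruct (Rlt_dec (4 * rho) (d j)); [lra|].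
      apply Rmult_le_pos; [apply Rabs_pos|apply Rlt_le, Rpower_pos]. }
    assert (Main : forall C', 0 <= C' -> C' <= C1 + C2 ->
      Rabs (c j) * (C' * t ^ K * Rpower (d j ^ 2) (- a)) <= u j).
    { intros C' HC' HC'2.
      replace (Rabs (c j) * (C' * t ^ K * Rpower (d j ^ 2) (- a))) with
        (C' * t ^ K * (Rabs (c j) * Rpower (d j ^ 2) (- a))) by ring.
      assert (HtK : 0 <= t ^ K) by (apply pow_le; assumption).
      assert (HCn : 0 <= C * (1 / 2) ^ j * d j ^ K).
      { eapply Rle_trans; [|exact HC].
        apply Rmult_le_pos; [apply Rabs_pos|apply Rlt_le, Rpower_pos]. }
      assert (HCj : 0 <= C * (1 / 2) ^ j).
      { apply Rmult_le_reg_r with (d j ^ K); [apply pow_lt; assumption|lra]. }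
      apply Rle_trans with (C' * t ^ K * (C * (1 / 2) ^ j * d j ^ K)).
      { apply Rmult_le_compat_l; [apply Rmult_le_pos; assumption|assumption]. }
      replace (C' * t ^ K * (C * (1 / 2) ^ j * d j ^ K)) with
        ((C * (1 / 2) ^ j) * (C' * (t * d j) ^ K)) by (rewrite Rpow_mult_distr; ring).
      unfold u. replace (C * (C1 + C2) * rho ^ K * (1 / 2) ^ j) with
        ((C * (1 / 2) ^ j) * ((C1 + C2) * rho ^ K)) by ring.
      apply Rmult_le_compat_l; [assumption|]. rewrite Htd.
      apply Rmult_le_compat; try assumption.
      - apply pow_le, sqrt_pos.
      - apply pow_incr. split; [apply sqrt_pos|assumption]. }
    rewrite Rabs_mult.
    destruct (Rle_lt_dec t (1 / 4)) as [Ht|Ht].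
    + apply Rle_trans with (u j); [|lra].
      eapply Rle_trans; [|apply (Main C1); lra].
      apply Rmult_le_compat_l; [apply Rabs_pos|]. exact (B1 _ _ _ _ _ NP Ht).
    + specialize (B2 _ _ _ _ _ NP (Rlt_le _ _ Ht)).
      destruct (bubble_pow_le n K a (d j) (r j) x Hn Ha (Hr j)) as [P1 P2].
      set (T := taylor K a (d j ^ 2 + r j ^ 2) (d j * x O) (sqn n x)) in *.
      set (N := corrected_bubble n K a (d j) (r j) x) in *.
      assert (HN : Rabs N <= C2 * t ^ K * Rpower (d j ^ 2) (- a) + Rpower (r j ^ 2) (- a)).
      { replace N with ((N + T) - T) by ring. eapply Rle_trans; [apply Rabs_triang|].
        rewrite Rabs_Ropp, (Rabs_right (N + T)) by lra. lra. }
      assert (Hw' : w j = Rabs (c j) * Rpower (r j ^ 2) (- a)).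
      { unfold w. destruct (Rlt_dec (4 * rho) (d j)) as [L|L]; [|reflexivity].
        exfalso. assert (1 / 4 * d j < t * d j) by (apply Rmult_lt_compat_r; lra). lra. }
      eapply Rle_trans; [apply Rmult_le_compat_l; [apply Rabs_pos|exact HN]|].
      rewrite Rmult_plus_distr_l, Hw'. apply Rplus_le_compat_r. apply Main; lra.
Qed.

Lemma family_summable n d r W : (0 < n)%nat ->
  (forall j, INR j + 1 <= d j) -> (forall j, 0 < r j) ->
  bubble_family n d r W -> summable_on_balls n W.
Proof.
  intros Hn Hd Hr H.
  induction H as [c|k W Hk HW IH|W1 W2 H1 IH1 H2 IH2|K a c C Ha HC]; [| | |
    now apply summable_bubble with C]; intros rho Hrho.
  - exists (fun j => Rabs (c * (1 / 2) ^ j)). split; [|intros; lra].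
    apply ex_series_ext with (fun j => Rabs c * (1 / 2) ^ j).
    + intros j. rewrite Rabs_mult. f_equal. symmetry. apply Rabs_right.
      apply Rle_ge, Rlt_le, half_pow_pos.
    + exact (ex_series_scal_l _ _ ex_series_half).
  - destruct (IH rho Hrho) as (b & Hb & B).
    exists (fun j => rho * b j). split; [exact (ex_series_scal_l rho b Hb)|].
    intros j x Hx. rewrite Rabs_mult.
    apply Rmult_le_compat; try apply Rabs_pos; [|auto].
    eapply Rle_trans; [now apply (coord_le_normn n)|].
    apply Rsqr_incr_0_var; [|assumption]. now rewrite !Rsqr_pow2, normn_sq.
  - destruct (IH1 rho Hrho) as (b1 & Hb1 & B1), (IH2 rho Hrho) as (b2 & Hb2 & B2).
    exists (fun j => b1 j + b2 j). split; [exact (ex_series_plus b1 b2 Hb1 Hb2)|].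
    intros j x Hx. eapply Rle_trans; [apply Rabs_triang|].
    apply Rplus_le_compat; auto.
Qed.

Section Families.
Context (n : nat) (d r : nat -> R).
Context (Hn : (0 < n)%nat) (Hd : forall j, INR j + 1 <= d j) (Hr : forall j, 0 < r j).

Lemma scale_ge_1 j : 1 <= d j.
Proof. specialize (Hd j). pose proof (pos_INR j). lra. Qed.

Lemma total_partial W i : (i < n)%nat -> bubble_family n d r W ->
  exists W', bubble_family n d r W' /\ (forall j, has_partial i (W j) (W' j)) /\
    has_partial i (total W) (total W').
Proof.
  intros Hi F.
  destruct (family_partial n d r W i scale_ge_1 Hr Hi F) as (W1 & F1 & D1).
  destruct (family_partial n d r W1 i scale_ge_1 Hr Hi F1) as (W2 & F2 & D2).
  exists W1. repeat split; auto.
  apply has_partial_total with (n := n) (W2 := W2); auto; apply (family_summable n d r); auto.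
Qed.

Lemma total_bounded W rho : bubble_family n d r W -> 0 <= rho ->
  exists M, forall x, sqn n x <= rho ^ 2 -> Rabs (total W x) <= M.
Proof.
  intros F Hrho. destruct (family_summable n d r W Hn Hd Hr F rho Hrho) as (b & Hb & B).
  exists (Series b). intros x Hx. apply series_dominated; auto.
Qed.

Lemma total_continuous W : bubble_family n d r W -> cont_punct n (total W).
Proof.
  intros F. apply cont_of_bounded_partials with (g := fun i => partial i (total W)).
  - intros i Hi. destruct (total_partial W i Hi F) as (W' & _ & _ & D).
    now rewrite (partial_eq _ _ _ D).
  - intros rho Hrho.
    assert (Q : forall k, (k <= n)%nat -> exists M, forall i x, (i < k)%nat ->
      sqn n x <= rho ^ 2 -> Rabs (partial i (total W) x) <= M).
    { induction k as [|k IH]; intros Hk; [exists 0; intros; lia|].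
      destruct (IH ltac:(lia)) as (M & HM).
      destruct (total_partial W k Hk F) as (W' & F' & _ & D).
      destruct (total_bounded W' rho F' Hrho) as (M' & HM').
      exists (Rmax M M'). intros i x Hi Hx. destruct (Nat.eq_dec i k) as [->|E].
      - rewrite (partial_eq _ _ _ D). eapply Rle_trans; [now apply HM'|apply Rmax_r].
      - eapply Rle_trans; [apply HM; [lia|assumption]|apply Rmax_l]. }
    exact (Q n (le_n n)).
Qed.

Lemma total_smooth W : bubble_family n d r W -> smooth_punct n (total W).
Proof.
  intros F l Hl.
  assert (E : exists W', bubble_family n d r W' /\ Dl l (total W) = total W').
  { induction Hl as [|i l Hi Hl (W' & F' & E)].
    - now exists W.
    - destruct (total_partial W' i Hi F') as (W'' & F'' & _ & D).
      exists W''. split; [assumption|].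
      change (partial i (Dl l (total W)) = total W''). rewrite E. now apply partial_eq. }
  destruct E as (W' & F' & ->). split; [now apply total_continuous|].
  intros i x Hi _. destruct (total_partial W' i Hi F') as (W'' & _ & _ & D).
  exists (total W'' x). apply D.
Qed.

Lemma family_sum_lt k (G : nat -> nat -> (nat -> R) -> R) :
  (forall i, (i < k)%nat -> bubble_family n d r (G i)) ->
  bubble_family n d r (fun j x => sum_lt k (fun i => G i j x)).
Proof.
  induction k as [|k IH]; intros H.
  - apply family_val with (1 := family_const n d r 0). intros; simpl; ring.
  - simpl. apply family_add; [apply IH; intros; apply H; lia|apply H; lia].
Qed.

Lemma total_sum_lt k (G : nat -> nat -> (nat -> R) -> R) x :
  (forall i, (i < k)%nat -> bubble_family n d r (G i)) ->
  sum_lt k (fun i => total (G i) x) = total (fun j x => sum_lt k (fun i => G i j x)) x.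
Proof.
  induction k as [|k IH]; intros H.
  - simpl. unfold total. rewrite (Series_ext _ (fun j => 0 * (1 / 2) ^ j)) by (intros; ring).
    rewrite Series_scal_l. ring.
  - simpl. rewrite IH by (intros; apply H; lia). unfold total. symmetry.
    assert (F : bubble_family n d r (fun j x => sum_lt k (fun i => G i j x)))
      by (apply family_sum_lt; intros; apply H; lia).
    apply Series_plus.
    + exact (summable_at n _ x (family_summable n d r _ Hn Hd Hr F)).
    + exact (summable_at n _ x (family_summable n d r _ Hn Hd Hr (H k ltac:(lia)))).
Qed.

Lemma total_laplacian W : bubble_family n d r W ->
  bubble_family n d r (fun j => laplacian n (W j)) /\
  laplacian n (total W) = total (fun j => laplacian n (W j)).
Proof.
  intros F.
  assert (Q : forall i, (i < n)%nat ->
    bubble_family n d r (fun j => partial i (partial i (W j))) /\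
    partial i (partial i (total W)) = total (fun j => partial i (partial i (W j)))).
  { intros i Hi. destruct (total_partial W i Hi F) as (W1 & F1 & D1 & T1).
    destruct (total_partial W1 i Hi F1) as (W2 & F2 & D2 & T2).
    replace (fun j => partial i (partial i (W j))) with W2.
    - split; [assumption|]. now rewrite (partial_eq _ _ _ T1), (partial_eq _ _ _ T2).
    - apply functional_extensionality; intros j.
      now rewrite (partial_eq _ _ _ (D1 j)), (partial_eq _ _ _ (D2 j)). }
  split.
  - apply (family_sum_lt n (fun i j => partial i (partial i (W j)))). apply Q.
  - apply functional_extensionality; intros x. unfold laplacian at 1.
    rewrite (sum_lt_ext n _ (fun i => total (fun j => partial i (partial i (W j))) x)).
    + apply (total_sum_lt n (fun i j => partial i (partial i (W j)))). apply Q.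
    + intros i Hi. now rewrite (proj2 (Q i Hi)).
Qed.

Lemma total_iter_lap W m : bubble_family n d r W ->
  bubble_family n d r (fun j => iter_lap m n (W j)) /\
  iter_lap m n (total W) = total (fun j => iter_lap m n (W j)).
Proof.
  intros F. induction m as [|m (F' & E)]; [now split|].
  destruct (total_laplacian _ F') as (F'' & E''). split; [exact F''|].
  change (laplacian n (iter_lap m n (total W)) = total (fun j => iter_lap (S m) n (W j))).
  now rewrite E.
Qed.

Lemma family_sqn_pow c k : bubble_family n d r (fun j x => c * (1 / 2) ^ j * sqn n x ^ k).
Proof.
  induction k as [|k IH].
  - eapply family_val; [apply (family_const n d r c)|]. intros; simpl; ring.
  - eapply family_val.
    + apply (family_sum_lt n (fun i j x => x i * (x i * (c * (1 / 2) ^ j * sqn n x ^ k)))).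
      intros i Hi. now repeat apply family_coord.
    + intros j x. cbv beta.
      rewrite (sum_lt_ext n _ (fun i => (c * (1 / 2) ^ j * sqn n x ^ k) * (x i ^ 2)))
        by (intros; ring).
      rewrite sum_lt_scal. fold (sqn n x). simpl; ring.
Qed.

End Families.

(** * Choice of the parameters *)

Lemma Rpower_sq d a : 0 < d -> Rpower (d ^ 2) a = Rpower d (2 * a).
Proof.
  intros Hd. rewrite <- (Rpower_pow 2 d Hd), Rpower_mult. reflexivity.
Qed.

Lemma Rpower_mult_base x y a : 0 < x -> 0 < y -> Rpower (x * y) a = Rpower x a * Rpower y a.
Proof. intros Hx Hy. symmetry. now apply Rpower_mult_distr. Qed.

(** With mass d^(n-2), the bound t^(2m-2) d^(2m-n) on the remainder, t = |x|/d, becomes exactly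
    |x|^(2m-2), whatever d is. *)
Lemma scale_power n m d : (1 <= m)%nat -> (2 * m < n)%nat -> 0 < d ->
  d ^ (n - 2) * Rpower (d ^ 2) (- (INR n / 2 - INR m)) = d ^ (2 * m - 2).
Proof.
  intros Hm Hn Hd. rewrite Rpower_sq by assumption.
  rewrite <- !(Rpower_pow _ d Hd), <- Rpower_plus. f_equal.
  rewrite !minus_INR, mult_INR by lia. simpl (INR 2). field.
Qed.

Lemma iter_lap_term n m d r k k' mu x :
  Nat.Odd m -> (2 * m < n)%nat -> 0 < r ->
  iter_lap m n (fun x => k * sqn n x ^ 0 + k' * sqn n x ^ (m - 1)
    + mu * corrected_bubble n (2 * m - 2) (INR n / 2 - INR m) d r x) x
  = - (4 ^ m * rising (INR n / 2 - INR m) (2 * m) * mu * r ^ (2 * m)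
       * Rpower (d ^ 2 + r ^ 2 - 2 * (d * x O) + sqn n x) (- (INR n / 2 + INR m))).
Proof.
  intros Hodd Hn Hr. assert (Hm : (0 < m)%nat) by (destruct Hodd; lia).
  erewrite (iter_lap_eq m n); cycle 1.
  { apply has_lap_iter_add; [apply has_lap_iter_add|apply has_lap_iter_scal].
    - apply has_lap_iter_sqn_pow; lia.
    - apply has_lap_iter_sqn_pow; lia.
    - apply has_lap_iter_corrected_bubble; [lia|assumption]. }
  (* The order is truncated to 0: no Taylor polynomial survives, and the source is that of the bare
     bubble. *)
  cbv beta. replace (2 * m - 2 - 2 * m)%nat with 0%nat by lia.
  unfold corrected_bubble, rem, taylor. simpl (sum_lt 0 _).
  (* Oddness of m fixes the sign. *)
  replace ((- 4) ^ m) with (- 4 ^ m); [ring|].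
  destruct Hodd as [l ->].
  rewrite !Nat.add_1_r, <- !tech_pow_Rmult, !pow_mult.
  replace ((- 4) ^ 2) with (4 ^ 2) by ring. ring.
Qed.

(* The pointwise constraint is most severe at the centre [Q = r^2], where it is a
   condition on [mu] and [r] only. *)
Lemma source_le_bubble_power h m lam c mu k r Q :
  0 < mu -> 0 < k -> 0 < r -> r ^ 2 <= Q ->
  0 < h + INR m - lam * (h - INR m) ->
  c * Rpower mu (1 - lam) = k * Rpower r (2 * h - 2 * lam * (h - INR m)) ->
  c * mu * r ^ (2 * m) * Rpower Q (- (h + INR m))
    <= k * Rpower (mu * Rpower Q (- (h - INR m))) lam.
Proof.
  intros Hmu Hk Hr HQ HE Hc.
  assert (Hr2 : 0 < r ^ 2) by now apply pow_lt.
  rewrite Rpower_mult_base by (assumption || apply Rpower_pos). rewrite Rpower_mult.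
  assert (E1 : c * mu = k * Rpower r (2 * h - 2 * lam * (h - INR m)) * Rpower mu lam).
  { rewrite <- Hc. rewrite <- (Rpower_1 mu) at 1 by assumption.
    rewrite Rmult_assoc, <- Rpower_plus. do 2 f_equal. ring. }
  rewrite E1.
  rewrite <- (Rpower_pow (2 * m) r Hr), mult_INR. simpl (INR 2).
  set (p := h + INR m - lam * (h - INR m)) in *.
  replace (k * Rpower r (2 * h - 2 * lam * (h - INR m)) * Rpower mu lam
    * Rpower r ((1 + 1) * INR m) * Rpower Q (- (h + INR m)))
    with (k * Rpower mu lam * (Rpower r (2 * h - 2 * lam * (h - INR m))
      * Rpower r ((1 + 1) * INR m) * Rpower Q (- (h + INR m)))) by ring.
  rewrite <- Rpower_plus.
  replace (2 * h - 2 * lam * (h - INR m) + (1 + 1) * INR m) with (2 * p) by (unfold p; ring).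
  rewrite <- Rpower_sq by assumption.
  rewrite <- (Rmult_assoc k (Rpower mu lam)). apply Rmult_le_compat_l.
  { apply Rmult_le_pos; [lra|apply Rlt_le, Rpower_pos]. }
  replace (- (h - INR m) * lam) with (p + - (h + INR m)) by (unfold p; ring).
  rewrite Rpower_plus. apply Rmult_le_compat_r; [apply Rlt_le, Rpower_pos|].
  apply Rle_Rpower_l; lra.
Qed.

(** With r <= d and Q >= d^2/2 the powers of d combine to (n-2) + 2m - (n+2m) = -2. One factor d
    absorbs the constant c 2^(n/2+m); the other is to spare. *)
Lemma source_near_origin n m c e k d r Q :
  (2 <= n)%nat -> 0 <= c -> 0 <= e <= k -> 1 <= d -> 0 < r <= d -> d ^ 2 / 2 <= Q ->
  c * Rpower 2 (INR n / 2 + INR m) <= d ->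
  c * (e * d ^ (n - 2)) * r ^ (2 * m) * Rpower Q (- (INR n / 2 + INR m)) <= k.
Proof.
  intros Hn Hc He Hd Hr HQ Hcd.
  assert (Hd2 : 0 < d ^ 2) by (apply pow_lt; lra).
  assert (Hdn : 0 <= d ^ (n - 2)) by (apply pow_le; lra).
  set (p := INR n / 2 + INR m) in *.
  assert (Hp : 0 <= p).
  { unfold p. pose proof (pos_INR n). pose proof (pos_INR m). lra. }
  apply Rle_trans with (c * (e * d ^ (n - 2)) * d ^ (2 * m) * (Rpower 2 p * Rpower (d ^ 2) (- p))).
  { apply Rmult_le_compat.
    - repeat apply Rmult_le_pos; try lra; apply pow_le; lra.
    - apply Rlt_le, Rpower_pos.
    - apply Rmult_le_compat_l; [repeat apply Rmult_le_pos; lra|].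
      apply pow_incr; lra.
    - apply Rle_trans with (Rpower (d ^ 2 / 2) (- p)); [apply Rpower_anti; lra|].
      assert (E2 : Rpower (/ 2) (- p) = Rpower 2 p).
      { unfold Rpower. rewrite ln_Rinv by lra. f_equal. ring. }
      unfold Rdiv. rewrite Rpower_mult_base, E2 by lra. apply Req_le. ring. }
  assert (E : d ^ (n - 2) * d ^ (2 * m) * Rpower (d ^ 2) (- p) * d <= 1).
  { apply Rle_trans with (Rpower d (INR (n - 2)) * Rpower d (INR (2 * m))
      * Rpower d (2 * - p) * Rpower d 1).
    - rewrite !Rpower_pow, Rpower_1, Rpower_sq by lra. apply Rle_refl.
    - rewrite <- !Rpower_plus. apply Rle_trans with (Rpower d 0).
      + apply Rle_Rpower; [lra|].
        rewrite minus_INR, mult_INR by lia. unfold p. simpl (INR 2). lra.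
      + rewrite Rpower_O by lra. apply Rle_refl. }
  replace (c * (e * d ^ (n - 2)) * d ^ (2 * m) * (Rpower 2 p * Rpower (d ^ 2) (- p))) with
    (e * ((c * Rpower 2 p) * (d ^ (n - 2) * d ^ (2 * m) * Rpower (d ^ 2) (- p)))) by ring.
  set (Y := d ^ (n - 2) * d ^ (2 * m) * Rpower (d ^ 2) (- p)) in *.
  assert (HY : 0 <= Y).
  { unfold Y. repeat apply Rmult_le_pos; try apply pow_le; try lra. apply Rlt_le, Rpower_pos. }
  assert (HcY : c * Rpower 2 p * Y <= 1).
  { apply Rle_trans with (d * Y); [apply Rmult_le_compat_r; assumption|lra]. }
  apply Rle_trans with (e * 1); [apply Rmult_le_compat_l; lra|lra].
Qed.

Lemma choose_scale n m lam b phi c e k j :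
  (1 <= m)%nat -> (2 * m < n)%nat -> 0 < lam ->
  0 < INR n - lam * (INR n - 2 * INR m) ->
  b = 2 * INR m * (INR n - 2) / (INR n - lam * (INR n - 2 * INR m)) ->
  (forall eps, 0 < eps -> exists R0, forall r, R0 < r -> Rabs (phi r) < eps) ->
  0 < c -> 0 < e -> 0 < k ->
  exists d r, INR j + 1 <= d /\ 1 < d /\ 0 < r <= d /\
    c * Rpower 2 (INR n / 2 + INR m) <= d /\
    c * Rpower (e * d ^ (n - 2)) (1 - lam)
      = k * Rpower r (INR n - lam * (INR n - 2 * INR m)) /\
    (INR j + 1) * (phi d * Rpower d b)
      < e * d ^ (n - 2) * Rpower (r ^ 2) (- (INR n / 2 - INR m)).
Proof.
  intros Hm Hn Hlam HD Hb Hphi Hc He Hk.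
  set (D := INR n - lam * (INR n - 2 * INR m)) in *.
  assert (Hj : 0 < INR j + 1) by (pose proof (pos_INR j); lra).
  (* Obtained by eliminating r and mu from mu r^(2m-n): this is the factor left in front of d^b. *)
  set (eta := Rpower (c / k) (- (INR n - 2 * INR m) / D) * Rpower e (2 * INR m / D)).
  assert (Heta : 0 < eta) by (apply Rmult_lt_0_compat; apply Rpower_pos).
  assert (Hck : 0 < c / k) by now apply Rdiv_lt_0_compat.
  destruct (Hphi (eta / (INR j + 1)) ltac:(now apply Rdiv_lt_0_compat)) as (R0 & HR0).
  set (g := c / k * Rpower e (1 - lam)).
  assert (Hg : 0 < g) by (apply Rmult_lt_0_compat; [assumption|apply Rpower_pos]).
  assert (Hc2 : 0 < c * Rpower 2 (INR n / 2 + INR m))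
    by (apply Rmult_lt_0_compat; [assumption|apply Rpower_pos]).
  (* A sum of positive lower bounds: j + 2 for growth, R0 for the smallness of phi, the constant for
     the source near the origin, and [g] for r <= d. *)
  set (d := INR j + 2 + Rabs R0 + c * Rpower 2 (INR n / 2 + INR m) + g).
  pose proof (Rabs_pos R0) as HR1. pose proof (Rle_abs R0) as HR2.
  pose proof (pos_INR j) as Hj0.
  assert (Hd : 1 < d) by (unfold d; lra).
  assert (Hdn : 0 < d ^ (n - 2)) by (apply pow_lt; lra).
  set (mu := e * d ^ (n - 2)).
  assert (Hmu : 0 < mu) by now apply Rmult_lt_0_compat.
  set (r := Rpower (c / k * Rpower mu (1 - lam)) (/ D)).
  assert (Hr : 0 < r) by apply Rpower_pos.
  assert (Hbase : 0 < c / k * Rpower mu (1 - lam))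
    by (apply Rmult_lt_0_compat; [assumption|apply Rpower_pos]).
  assert (HrD : Rpower r D = c / k * Rpower mu (1 - lam)).
  { unfold r. rewrite Rpower_mult, Rinv_l, Rpower_1; lra. }
  assert (Hdpow : d ^ (n - 2) = Rpower d (INR n - 2)).
  { rewrite <- Rpower_pow by lra. f_equal. rewrite minus_INR by lia. simpl; ring. }
  assert (Hm1 : 1 <= INR m) by (apply (le_INR 1); assumption).
  exists d, r. repeat split; try assumption; try (unfold d; lra).
  (* Here r^D = g d^((n-2)(1-lam)), and D exceeds that exponent by 2 + 2 lam (m-1); since d >= g, a
     gain of 1 is enough. *)
  - destruct (Rle_lt_dec r d) as [L|L]; [assumption|exfalso].
    assert (A1 : Rpower d D < Rpower r D) by (apply Rlt_Rpower_l; lra).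
    rewrite HrD in A1. unfold mu in A1. rewrite Rpower_mult_base in A1 by assumption.
    rewrite Hdpow, Rpower_mult, <- Rmult_assoc in A1. fold g in A1.
    assert (A2 : g * Rpower d ((INR n - 2) * (1 - lam)) <= d * Rpower d ((INR n - 2) * (1 - lam))).
    { apply Rmult_le_compat_r; [apply Rlt_le, Rpower_pos|unfold d; lra]. }
    assert (A3 : d * Rpower d ((INR n - 2) * (1 - lam)) <= Rpower d D).
    { rewrite <- (Rpower_1 d) at 1 by lra. rewrite <- Rpower_plus.
      apply Rle_Rpower; [lra|]. unfold D.
      assert (0 <= lam * (INR m - 1)) by (apply Rmult_le_pos; lra). lra. }
    lra.
  - fold mu. rewrite HrD. field. lra.
  - fold mu.
    assert (E : mu * Rpower (r ^ 2) (- (INR n / 2 - INR m)) = eta * Rpower d b).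
    { rewrite Rpower_sq by assumption.
      replace (2 * - (INR n / 2 - INR m)) with (D * (- (INR n - 2 * INR m) / D)) by (field; lra).
      rewrite <- Rpower_mult, HrD, Rpower_mult_base by (assumption || apply Rpower_pos).
      rewrite Rpower_mult. unfold eta.
      rewrite <- (Rpower_1 mu) at 1 by assumption.
      transitivity (Rpower (c / k) (- (INR n - 2 * INR m) / D)
        * (Rpower mu 1 * Rpower mu ((1 - lam) * (- (INR n - 2 * INR m) / D)))); [ring|].
      rewrite <- Rpower_plus, Rmult_assoc. f_equal.
      replace (1 + (1 - lam) * (- (INR n - 2 * INR m) / D)) with (2 * INR m / D)
        by (unfold D; field; unfold D in HD; lra).
      unfold mu. rewrite Rpower_mult_base by assumption. f_equal.
      rewrite Hdpow, Rpower_mult, Hb. f_equal. field. lra. }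
    rewrite E, <- Rmult_assoc. apply Rmult_lt_compat_r; [apply Rpower_pos|].
    specialize (HR0 d ltac:(unfold d; lra)). pose proof (Rle_abs (phi d)).
    apply Rlt_le_trans with ((INR j + 1) * (eta / (INR j + 1))).
    + apply Rmult_lt_compat_l; lra.
    + apply Req_le. field. lra.
Qed.

(** * Positivity of the terms and assembly of the solution *)

Lemma series_nonneg (a : nat -> R) : (forall i, 0 <= a i) -> ex_series a -> 0 <= Series a.
Proof.
  intros Ha He. replace 0 with (Series (fun j => 0 * a j)) by (rewrite Series_scal_l; ring).
  apply Series_le; [|assumption]. intros j. specialize (Ha j). lra.
Qed.

Lemma series_ge_term j : forall a : nat -> R,
  (forall i, 0 <= a i) -> ex_series a -> a j <= Series a.
Proof.
  induction j as [|j IH]; intros a Ha He.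
  - rewrite (Series_incr_1 a He).
    assert (0 <= Series (fun i => a (S i))); [|lra].
    apply series_nonneg; [intros; apply Ha|now apply (ex_series_incr_1 a)].
  - rewrite (Series_incr_1 a He). specialize (Ha O) as H0.
    apply Rle_trans with (Series (fun i => a (S i))); [|lra].
    apply (IH (fun i => a (S i))); [intros; apply Ha|now apply (ex_series_incr_1 a)].
Qed.

Lemma Series_half : Series (fun j => 1 / 2 * (1 / 2) ^ j) = 1.
Proof. rewrite Series_scal_l, Series_geom by (rewrite Rabs_right; lra). field. Qed.

(* Subtracting the Taylor polynomial of degree [2m-3] costs at most [k |x|^(2m-2)], once
   the mass is [mu = e d^(n-2)]. *)
Lemma term_lower_bound n m : (1 <= m)%nat -> (2 * m < n)%nat ->
  exists C, 1 <= C /\ forall k d r x, 0 < k -> 0 < d -> 0 < r ->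
    let P := Rpower (d ^ 2 + r ^ 2 - 2 * (d * x O) + sqn n x) (- (INR n / 2 - INR m)) in
    let B := corrected_bubble n (2 * m - 2) (INR n / 2 - INR m) d r x in
    let mu := k / C * d ^ (n - 2) in
    (normn n x <= d / 4 -> 0 <= k * sqn n x ^ (m - 1) + mu * B) /\
    (d / 4 <= normn n x -> mu * P <= k * sqn n x ^ (m - 1) + mu * B).
Proof.
  intros Hm Hn.
  assert (Ha : 0 < INR n / 2 - INR m).
  { apply lt_INR in Hn. rewrite mult_INR in Hn. simpl (INR 2) in Hn. lra. }
  destruct (rem_bound (2 * m - 2) _ Ha) as (C1 & HC1 & B1).
  destruct (taylor_bound (2 * m - 2) _ Ha) as (C2 & HC2 & B2).
  (* C1 serves the remainder near the origin and C2 the polynomial away from it; the summand 1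
     ensures k/C <= k. *)
  exists (1 + C1 + C2). split; [lra|]. intros k d r x Hk Hd Hr P B mu.
  pose proof (corrected_bubble_near_pole n d r x ltac:(lia) Hd) as NP.
  set (t := normn n x / d) in *.
  assert (Ht : normn n x = t * d) by (unfold t; field; lra).
  assert (Ht0 : 0 <= t) by apply NP.
  assert (Hmu : 0 < mu).
  { unfold mu. apply Rmult_lt_0_compat; [apply Rdiv_lt_0_compat; lra|now apply pow_lt]. }
  assert (Key : forall C' X, 0 <= C' -> C' <= 1 + C1 + C2 ->
    Rabs X <= C' * t ^ (2 * m - 2) * Rpower (d ^ 2) (- (INR n / 2 - INR m)) ->
    - (k * sqn n x ^ (m - 1)) <= mu * X).
  { intros C' X HC' HC'2 HX.
    assert (Hq : sqn n x ^ (m - 1) = (t * d) ^ (2 * m - 2)).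
    { rewrite <- Ht, <- normn_sq, <- pow_mult. f_equal. lia. }
    assert (Hq0 : 0 <= sqn n x ^ (m - 1)) by (apply pow_le, sqn_nonneg).
    assert (mu * Rabs X <= k * sqn n x ^ (m - 1)).
    { apply Rle_trans with
        (mu * (C' * t ^ (2 * m - 2) * Rpower (d ^ 2) (- (INR n / 2 - INR m)))).
      - apply Rmult_le_compat_l; lra.
      - unfold mu.
        replace (k / (1 + C1 + C2) * d ^ (n - 2) *
          (C' * t ^ (2 * m - 2) * Rpower (d ^ 2) (- (INR n / 2 - INR m)))) with
          (C' * (k / (1 + C1 + C2)) * (t ^ (2 * m - 2)
            * (d ^ (n - 2) * Rpower (d ^ 2) (- (INR n / 2 - INR m))))) by ring.
        rewrite scale_power by assumption. rewrite <- Rpow_mult_distr, <- Hq.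
        apply Rmult_le_compat_r; [assumption|].
        apply Rle_trans with ((1 + C1 + C2) * (k / (1 + C1 + C2))).
        + apply Rmult_le_compat_r; [apply Rlt_le, Rdiv_lt_0_compat; lra|assumption].
        + apply Req_le. field. lra. }
    pose proof (Rle_abs (- X)). rewrite Rabs_Ropp in *.
    assert (mu * (- X) <= mu * Rabs X) by (apply Rmult_le_compat_l; lra). lra. }
  split; intros Hx.
  - assert (t <= 1 / 4) by (apply Rmult_le_reg_r with d; lra).
    specialize (Key C1 B HC1 ltac:(lra) (B1 _ _ _ _ _ NP H)). lra.
  - assert (Ht4 : 1 / 4 <= t) by (apply Rmult_le_reg_r with d; lra).
    specialize (B2 _ _ _ _ _ NP Ht4). rewrite <- Rabs_Ropp in B2.
    specialize (Key C2 _ HC2 ltac:(lra) B2).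
    unfold B, corrected_bubble, rem. fold P. lra.
Qed.

Theorem theorem1p17 (m n : nat) (lam b : R) (phi : R -> R)
  (hm_odd : Nat.Odd m) (hm3 : (3 <= m)%nat) (hn : (2 * m < n)%nat)
  (hlam0 : 0 < lam) (hlam1 : lam < INR n / (INR n - 2 * INR m))
  (hb : b = 2 * INR m * (INR n - 2) / (INR n - lam * (INR n - 2 * INR m)))
  (hphi_range : forall r, 1 < r -> 0 < phi r < 1)
  (hphi_cont : forall r, 1 < r -> continuity_pt phi r)
  (hphi_lim : forall eps, 0 < eps -> exists R0, forall r, R0 < r -> Rabs (phi r) < eps) :
  exists v : (nat -> R) -> R,
    smooth_punct n v /\
    (forall x, punctured n x -> 0 < v x) /\
    (forall x, punctured n x ->
       0 <= - iter_lap m n v x /\ - iter_lap m n v x <= Rpower (v x) lam) /\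
    (* limsup_{|y| -> oo} v(y) / (phi(|y|) |y|^b) = oo *)
    (forall M R0, exists y, punctured n y /\ R0 < normn n y /\
       M < v y / (phi (normn n y) * Rpower (normn n y) b)).
Proof.
  assert (Hm1 : 1 <= INR m) by (apply (le_INR 1); lia).
  assert (Hs : 0 < INR n - 2 * INR m).
  { pose proof (lt_INR _ _ hn) as L. rewrite mult_INR in L. simpl (INR 2) in L. lra. }
  set (s := INR n / 2 - INR m).
  assert (Hs' : 0 < s) by (unfold s; lra).
  assert (HD : 0 < INR n - lam * (INR n - 2 * INR m)).
  { apply (Rmult_lt_compat_r (INR n - 2 * INR m)) in hlam1; [|assumption].
    unfold Rdiv in hlam1. rewrite Rmult_assoc, Rinv_l in hlam1; lra. }
  destruct (term_lower_bound n m ltac:(lia) hn) as (C & HC & LB).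
  set (c := 4 ^ m * rising s (2 * m)).
  assert (Hc : 0 < c).
  { apply Rmult_lt_0_compat; [apply pow_lt; lra|now apply rising_pos]. }
  (* The weights sum to 1, so adding the bounds W_j >= k_j gives v >= 1, and adding the source
     bounds k_j v^lam gives v^lam without a constant. *)
  set (k := fun j => 1 / 2 * (1 / 2) ^ j).
  assert (Hk : forall j, 0 < k j)
    by (intros j; apply Rmult_lt_0_compat; [lra|apply half_pow_pos]).
  assert (HkC : forall j, 0 < k j / C) by (intros j; apply Rdiv_lt_0_compat; [auto|lra]).
  set (sel := fun j (dr : R * R) => let (d, r) := dr in
    INR j + 1 <= d /\ 1 < d /\ 0 < r <= d /\
    c * Rpower 2 (INR n / 2 + INR m) <= d /\
    c * Rpower (k j / C * d ^ (n - 2)) (1 - lam)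
      = k j * Rpower r (INR n - lam * (INR n - 2 * INR m)) /\
    (INR j + 1) * (phi d * Rpower d b) < k j / C * d ^ (n - 2) * Rpower (r ^ 2) (- s)).
  assert (Hsel : forall j, exists dr, sel j dr).
  { intros j. destruct (choose_scale n m lam b phi c (k j / C) (k j) j)
      as (d & r & H); auto; [lia|]. now exists (d, r). }
  set (dr := fun j => proj1_sig (constructive_indefinite_description _ (Hsel j))).
  set (d := fun j => fst (dr j)). set (r := fun j => snd (dr j)).
  assert (HP : forall j, sel j (d j, r j)).
  { intros j. unfold d, r. rewrite <- surjective_pairing.
    exact (proj2_sig (constructive_indefinite_description _ (Hsel j))). }
  clearbody d r. clear dr Hsel. unfold sel in HP. clear sel.
  assert (Hdj : forall j, INR j + 1 <= d j) by (intros j; apply HP).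
  assert (Hd1 : forall j, 1 < d j) by (intros j; apply HP).
  assert (Hr : forall j, 0 < r j) by (intros j; apply HP).
  set (mu := fun j => k j / C * d j ^ (n - 2)).
  assert (Hmu : forall j, 0 < mu j).
  { intros j. apply Rmult_lt_0_compat; [auto|apply pow_lt]. specialize (Hd1 j); lra. }
  set (W := fun j x => k j * sqn n x ^ 0 + k j * sqn n x ^ (m - 1)
    + mu j * corrected_bubble n (2 * m - 2) s (d j) (r j) x).
  assert (Hn0 : (0 < n)%nat) by lia.
  assert (FW : bubble_family n d r W).
  { apply family_add; [apply family_add; apply family_sqn_pow; assumption|].
    apply family_bubble with (C := 1 / 2 / C); [assumption|]. intros j.
    rewrite Rabs_right by (apply Rle_ge, Rlt_le, Hmu). unfold mu, s.
    rewrite Rmult_assoc, scale_power by (lia || (specialize (Hd1 j); lra)).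
    apply Req_le. unfold k. field. lra. }
  assert (Wk : forall j x, k j <= W j x /\ (d j / 4 <= normn n x ->
    mu j * Rpower (d j ^ 2 + r j ^ 2 - 2 * (d j * x O) + sqn n x) (- s) <= W j x)).
  { intros j x. specialize (Hd1 j).
    destruct (LB (k j) (d j) (r j) x (Hk j) ltac:(lra) (Hr j)) as [L1 L2].
    fold s in L1, L2. fold (mu j) in L1, L2. unfold W. simpl (_ ^ 0).
    specialize (Hk j). split.
    - destruct (Rle_lt_dec (normn n x) (d j / 4)) as [L|L]; [specialize (L1 L); lra|].
      specialize (L2 (Rlt_le _ _ L)).
      assert (0 < mu j * Rpower (d j ^ 2 + r j ^ 2 - 2 * (d j * x O) + sqn n x) (- s))
        by (apply Rmult_lt_0_compat; [auto|apply Rpower_pos]).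
      lra.
    - intros L. specialize (L2 L). lra. }
  assert (HexW : forall x, ex_series (fun j => W j x)).
  { intros x. exact (summable_at n W x (family_summable n d r W Hn0 Hdj Hr FW)). }
  assert (V1 : forall x, 1 <= total W x).
  { intros x. rewrite <- Series_half. apply Series_le; [|apply HexW].
    intros j. split; [apply Rlt_le, Hk|apply Wk]. }
  assert (VW : forall j x, W j x <= total W x).
  { intros j x. apply (series_ge_term j (fun j => W j x)); [|apply HexW].
    intros i. specialize (Hk i). destruct (Wk i x). lra. }
  exists (total W). split; [now apply (total_smooth n d r)|].
  split; [intros x _; specialize (V1 x); lra|]. split.
  - intros x _.
    destruct (total_iter_lap n d r Hn0 Hdj Hr W m FW) as [FL ->].
    set (f := fun j => c * mu j * r j ^ (2 * m)
      * Rpower (d j ^ 2 + r j ^ 2 - 2 * (d j * x O) + sqn n x) (- (INR n / 2 + INR m))).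
    assert (E : forall j, iter_lap m n (W j) x = - f j)
      by (intros j; unfold W; now apply iter_lap_term).
    assert (F0 : forall j, 0 <= f j).
    { intros j. unfold f. apply Rmult_le_pos; [|apply Rlt_le, Rpower_pos].
      apply Rmult_le_pos; [|apply pow_le, Rlt_le, Hr].
      apply Rmult_le_pos; apply Rlt_le; auto. }
    assert (F1 : forall j, f j <= k j * Rpower (total W x) lam).
    { intros j. destruct (HP j) as (_ & Hd & Hrj & Hbig & Hcal & _).
      pose proof (bubble_base_ge n (d j) (r j) x Hn0) as HQ.
      set (Q := d j ^ 2 + r j ^ 2 - 2 * (d j * x O) + sqn n x) in *.
      destruct (Rle_lt_dec (normn n x) (d j / 4)) as [L|L].
      - apply Rle_trans with (k j).
        + unfold f, mu. fold Q. apply source_near_origin; try assumption; try lia; try lra.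
          * split; [apply Rlt_le, HkC|].
            apply Rmult_le_reg_r with C; [lra|]. unfold Rdiv.
            rewrite Rmult_assoc, Rinv_l by lra. specialize (Hk j). nra.
          * pose proof (corrected_bubble_near_pole n (d j) (r j) x Hn0 ltac:(lra)) as NP.
            apply (near_pole_gap _ _ _ _ _ NP).
            apply Rmult_le_reg_r with (d j); [lra|].
            unfold Rdiv at 1. rewrite Rmult_assoc, Rinv_l by lra. lra.
        + rewrite <- (Rmult_1_r (k j)) at 1. apply Rmult_le_compat_l; [apply Rlt_le, Hk|].
          specialize (V1 x). rewrite <- (Rpower_O (total W x)) by lra.
          apply Rle_Rpower; lra.
      - apply Rle_trans with (k j * Rpower (mu j * Rpower Q (- s)) lam).
        + unfold f, s. fold Q. apply source_le_bubble_power; auto; [lra|].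
          fold (mu j) in Hcal. rewrite Hcal. do 2 f_equal. field.
        + apply Rmult_le_compat_l; [apply Rlt_le, Hk|]. apply Rle_Rpower_l; [lra|].
          split; [apply Rmult_lt_0_compat; [auto|apply Rpower_pos]|].
          eapply Rle_trans; [apply (proj2 (Wk j x)); lra|apply VW]. }
    assert (Hek : ex_series (fun j => k j * Rpower (total W x) lam)).
    { apply ex_series_ext with (fun j => (1 / 2 * Rpower (total W x) lam) * (1 / 2) ^ j).
      - intros j. unfold k. simpl. ring.
      - exact (ex_series_scal_l _ _ ex_series_half). }
    assert (S1 : - total (fun j => iter_lap m n (W j)) x = Series f).
    { unfold total at 1. rewrite <- Series_opp. apply Series_ext. intros j. rewrite E. ring. }
    assert (S2 : 0 <= Series f <= Series (fun j => k j * Rpower (total W x) lam)).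
    { split; [|apply Series_le; auto].
      apply series_nonneg; [assumption|].
      apply (series_dominated f (fun j => k j * Rpower (total W x) lam)); [|assumption].
      intros j. rewrite Rabs_right; [auto|apply Rle_ge, F0]. }
    rewrite Series_scal_r in S2. unfold k in S2. rewrite Series_half in S2. lra.
  - intros M R0.
    (* One index beats both: d_j >= j + 1 > R0, and the peak exceeds phi(d_j) d_j^b by a factor
       above j + 1 > M. *)
    destruct (INR_unbounded (Rabs M + Rabs R0)) as (j & Hj).
    pose proof (Rle_abs M). pose proof (Rle_abs R0).
    pose proof (Rabs_pos M). pose proof (Rabs_pos R0).
    destruct (HP j) as (Hjd & Hd & Hrj & _ & _ & Hpk). fold (mu j) in Hpk.
    (* The centre of the j-th bubble, where the base equals r_j^2. It is far enough from the origin
       for the lower bound of W_j by the bare bubble. *)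
    set (y := fun i => if Nat.eqb i 0 then d j else 0).
    assert (Hq : sqn n y = d j ^ 2).
    { unfold sqn. rewrite (sum_lt_ext n _ (fun i => (if Nat.eqb i 0 then d j else 0) * y i)).
      - rewrite sum_lt_head by assumption. unfold y. simpl. ring.
      - intros i _. unfold y. ring. }
    assert (Hy : normn n y = d j).
    { change (sqrt (sqn n y) = d j). rewrite Hq. apply sqrt_pow2. lra. }
    exists y. rewrite Hy. split; [|split; [lra|]].
    + split.
      * intros i Hi. unfold y. destruct (Nat.eqb_spec i 0); [lia|reflexivity].
      * exists O. split; [assumption|]. unfold y. simpl. lra.
    + pose proof (hphi_range (d j) Hd) as Hph.
      assert (HX : 0 < phi (d j) * Rpower (d j) b)
        by (apply Rmult_lt_0_compat; [lra|apply Rpower_pos]).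
      apply Rlt_div_r; [assumption|].
      apply Rle_lt_trans with ((INR j + 1) * (phi (d j) * Rpower (d j) b)).
      { apply Rmult_le_compat_r; lra. }
      eapply Rlt_le_trans; [exact Hpk|].
      eapply Rle_trans; [|apply (VW j)].
      assert (Hfar : d j / 4 <= normn n y) by (rewrite Hy; lra).
      apply Wk in Hfar. rewrite Hq in Hfar.
      replace (d j ^ 2 + r j ^ 2 - 2 * (d j * y O) + d j ^ 2) with (r j ^ 2) in Hfar
        by (unfold y; simpl; ring).
      exact Hfar.
Qed.
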